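(* Let $n\in\mathbb{N}$, let $\mu_1,\ldots,\mu_n>0$ be distinct, and let $\omega\in[0,1]$. Let $C_i(k)$, $f_{ki}(t)$, $g_{ki}(t)$, $p_{k\ell,i}(t)$ be as defined in the context (dynamic appointment scheduling of $n$ clients, the service time of client $i$ being exponential with mean $1/\mu_i$). Then the $C_i(k)$ are determined recursively by: for $i=1,\ldots,n-1$ and $k=1,\ldots,i$, $$C_{i}(k) =\inf_{t\geqslant 0}\left(\omega\,f_{ki}(t)+(1-\omega)\,g_{ki}(t)+ \sum_{\ell=1}^{k+1} p_{k\ell,i}(t)\, C_{i+1}(\ell)\right),$$ whereas, for $k=1,\ldots,n$, $$C_{n}(k) =(1-\omega)\lim_{t\to\infty}g_{kn}(t)=(1-\omega)\sum_{\ell=0}^{k-1} (k-\ell-1)\frac{1}{\mu_{n-k+\ell+1}}.$$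
   Context: Model. Clients $1,\ldots,n$ arrive punctually, in this order, at a single server that serves them in order of arrival without idling when clients are present. Service times are independent, that of client $i$ being exponentially distributed with mean $1/\mu_i$. Immediately after the arrival of client $i<n$, the time $t\geqslant 0$ until the arrival of client $i+1$ is chosen as a function of $i$ and the number $k$ of clients then in the system (including the one just arrived and the one in service); these are then clients $i-k+1,\ldots,i$. A policy is a collection of such decision functions $\tau_j(\cdot)\geqslant 0$, $j=1,\ldots,n-1$. Cost. $C_i(k)$ is the infimum over policies of the expected cost incurred from the arrival of client $i$ onwards, given that immediately after this arrival there are $k$ clients in the system. The cost is $\omega$ times the total time the server is idle between the arrival of client $i$ and the arrival of client $n$, plus $(1-\omega)$ times the integral over time, from the arrival of client $i$ until all $n$ clients have left, of the number of waiting clients (clients present but not in service). Notation. For $k\geqslant 1$, $\ell\geqslant 0$, $k+\ell\leqslant n$, define real coefficients $c_{k\ell j}$, $j=k,\ldots,k+\ell$, by $c_{k0k}=\mu_k$ and $$c_{k,\ell+1, j}=c_{k\ell j} \frac{\mu_{k+\ell+1}}{\mu_{k+\ell+1}-\mu_j }\ (j=k,\ldots,k+\ell),\qquad c_{k,\ell+1, k+\ell+1}= \sum_{j=k}^{k+\ell} c_{k\ell j} \frac{\mu_{k+\ell+1}}{\mu_j-\mu_{k+\ell+1} },$$ and let $\varphi_{k\ell}(s)=\sum_{j=k}^{k+\ell}c_{k\ell j}e^{-\mu_j s}$ (the density of the sum of independent exponential random variables with rates $\mu_k,\ldots,\mu_{k+\ell}$). Let $\psi_j(t)=(1-e^{-\mu_j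 t})/\mu_j$. For $1\leqslant k\leqslant i\leqslant n$ and $t\geqslant 0$ define $$f_{ki}(t)=t - \sum_{j=i-k+1}^i \frac{c_{i-k+1,k-1,j}}{\mu_j}\psi_j(t),$$ $$g_{ki}(t)= \sum_{\ell=0}^{k-1}(k-\ell-1)\sum_{j=i-k+1}^{i-k+\ell+1}\frac{c_{i-k+1,\ell,j}}{\mu_{i-k+\ell+1}}\psi_{j}(t),$$ $$p_{k\ell,i}(t) = \frac{\varphi_{i-k+1,k-\ell+1}(t)}{\mu_{i-\ell+2}}\ (\ell=2,\ldots,k+1),\qquad p_{k1,i}(t) = 1 - \sum_{\ell=2}^{k+1}p_{k\ell,i}(t).$$ *)

(* Defs.v *)
(* MathComp-Analysis, over an arbitrary R : realType. Clients are numbered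
   1, ..., n by natural numbers; families indexed by clients are functions on
   nat of which only the values at 1, ..., n matter. *)
From mathcomp Require Import all_boot all_order all_algebra.
From mathcomp Require Import all_classical all_reals all_analysis.
Import Order.TTheory GRing.Theory Num.Theory.
Import numFieldNormedType.Exports.

Set Implicit Arguments.
Unset Strict Implicit.
Unset Printing Implicit Defensive.

Local Open Scope classical_set_scope.
Local Open Scope ring_scope.

(** * Coefficients *)

(* [coef mu k l j] is c_{klj}; it is 0 for j outside k, ..., k + l. *)
Fixpoint coef (R : realType) (mu : nat -> R) (k l j : nat) : R :=
  if l is l'.+1 then
    if j == (k + l)%N then
      \sum_(k <= m < k + l) coef mu k l' m * (mu (k + l)%N / (mu m - mu (k + l)%N))
    else coef mu k l' j * (mu (k + l)%N / (mu (k + l)%N - mu j))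
  else if j == k then mu k else 0.

Definition phi (R : realType) (mu : nat -> R) (k l : nat) (s : R) : R :=
  \sum_(k <= j < (k + l).+1) coef mu k l j * expR (- mu j * s).

Definition psi (R : realType) (mu : nat -> R) (j : nat) (t : R) : R :=
  (1 - expR (- mu j * t)) / mu j.

Definition f (R : realType) (mu : nat -> R) (k i : nat) (t : R) : R :=
  t - \sum_((i - k).+1 <= j < i.+1)
        coef mu (i - k).+1 k.-1 j / mu j * psi mu j t.

Definition g (R : realType) (mu : nat -> R) (k i : nat) (t : R) : R :=
  \sum_(0 <= l < k) (k - l - 1)%:R *
    \sum_((i - k).+1 <= j < (i - k + l + 1).+1)
      coef mu (i - k).+1 l j / mu (i - k + l + 1)%N * psi mu j t.

(* p_{kl,i}(t) for l = 2, ..., k + 1 *)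
Definition p_ge2 (R : realType) (mu : nat -> R) (k l i : nat) (t : R) : R :=
  phi mu (i - k).+1 (k + 1 - l) t / mu (i + 2 - l)%N.

Definition p (R : realType) (mu : nat -> R) (k l i : nat) (t : R) : R :=
  if l == 1%N then 1 - \sum_(2 <= m < k.+2) p_ge2 mu k m i t
  else p_ge2 mu k l i t.

(** * Sample paths of the queue *)

(* [tau j k] is the time between the arrivals of clients j and j + 1 when k
   clients are in the system just after the arrival of client j. *)
Definition policy (R : realType) (tau : nat -> nat -> R) : Prop :=
  forall j k, 0 <= tau j k.

(* For service times b 1, b 2, ...: the arrival time of client i, and the
   sequence of the departure times of clients 1, ..., i. Client 1 arrives at
   time 0. A client whose departure coincides with an arrival is no longer
   counted as present at that arrival. *)
Fixpoint history (R : realType) (tau : nat -> nat -> R) (b : nat -> R)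
    (i : nat) : R * seq R :=
  if i is i'.+1 then
    let: (a, ds) := history tau b i' in
    let a' := if i' == 0%N then 0
              else a + tau i' (count (fun d => a < d) ds) in
    (a', rcons ds (Num.max a' (last 0 ds) + b i))
  else (0, [::]).

Definition arrival (R : realType) (tau : nat -> nat -> R) (b : nat -> R)
    (i : nat) : R := (history tau b i).1.

Definition departure (R : realType) (tau : nat -> nat -> R) (b : nat -> R)
    (i : nat) : R := last 0 (history tau b i).2.

Definition service_start (R : realType) (tau : nat -> nat -> R) (b : nat -> R)
    (i : nat) : R := Num.max (arrival tau b i) (departure tau b i.-1).

(* Number of clients in the system immediately after the arrival of client i,
   client i included. Only clients 1, ..., i are counted: if the next
   interarrival time is 0, client i + 1 arrives at the same time, but later. *)
Definition nb_in_system (R : realType) (tau : nat -> nat -> R) (b : nat -> R)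
    (i : nat) : nat :=
  count (fun d => arrival tau b i < d) (history tau b i).2.

Definition present (R : realType) (tau : nat -> nat -> R) (b : nat -> R)
    (j : nat) (s : R) : bool :=
  arrival tau b j <= s < departure tau b j.

Definition in_service (R : realType) (tau : nat -> nat -> R) (b : nat -> R)
    (j : nat) (s : R) : bool :=
  service_start tau b j <= s < departure tau b j.

Definition idle (R : realType) (n : nat) (tau : nat -> nat -> R)
    (b : nat -> R) (s : R) : bool :=
  ~~ has (fun j => in_service tau b j s) (iota 1 n).

Definition nb_waiting (R : realType) (n : nat) (tau : nat -> nat -> R)
    (b : nat -> R) (s : R) : nat :=
  count (fun j => present tau b j s && ~~ in_service tau b j s) (iota 1 n).

Definition cost (R : realType) (n : nat) (omega : R) (tau : nat -> nat -> R)
    (i : nat) (b : nat -> R) : \bar R :=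
  (omega%:E * lebesgue_measure
     (`[arrival tau b i, arrival tau b n] `&` [set s | idle n tau b s])
   + (1 - omega)%:E * \int[lebesgue_measure]_(s in
       `[arrival tau b i, departure tau b n]) (nb_waiting n tau b s)%:R%:E)%E.

(** * Random service times *)

Definition mutually_independent (d : measure_display) (T : measurableType d)
    (R : realType) (P : probability T R) (n : nat)
    (B : nat -> {RV P >-> R}) : Prop :=
  forall (J : seq nat) (A : nat -> set R),
    uniq J -> {in J, forall j, (1 <= j <= n)%N} ->
    (forall j, measurable (A j)) ->
    P (\bigcap_(j in [set` J]) (B j @^-1` A j)) =
      (\prod_(j <- J) P (B j @^-1` A j))%E.

Definition exponentially_distributed (d : measure_display)
    (T : measurableType d) (R : realType) (P : probability T R)
    (rate : R) (X : {RV P >-> R}) : Prop :=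
  forall A : set R, measurable A -> distribution P X A = exponential_prob rate A.

(* E[X | E] for an event E of positive probability *)
Definition cond_expectation (d : measure_display) (T : measurableType d)
    (R : realType) (P : probability T R) (X : T -> \bar R) (E : set T) : \bar R :=
  ((\int[P]_(x in E) X x) / P E)%E.

Definition state_event (d : measure_display) (T : measurableType d)
    (R : realType) (P : probability T R) (B : nat -> {RV P >-> R})
    (tau : nat -> nat -> R) (i k : nat) : set T :=
  [set x | nb_in_system tau (fun j => B j x) i = k].

(* C_i(k). The infimum ranges over the policies for which the conditioning
   event has positive probability. There are such policies whenever
   1 <= k <= i, for instance those with tau j k > 0 for all j and k. *)
Definition optimal_cost (d : measure_display) (T : measurableType d)
    (R : realType) (P : probability T R) (n : nat) (omega : R)
    (B : nat -> {RV P >-> R}) (i k : nat) : \bar R :=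
  ereal_inf
    [set cond_expectation P (fun x => cost n omega tau i (fun j => B j x))
           (state_event B tau i k)
     | tau in [set tau | policy tau /\ (0 < P (state_event B tau i k))%E]].

(* Main.v *)
(* By the memoryless property, the state just after an arrival can be described
   by a vector of service times that again has the product exponential law: if
   client q is in service at the next arrival, an event that depends on the
   earlier service times and on the service time of q exceeding a certain amount,
   then the excess of that service time is exponential and independent of the
   event. So the expected cost of a policy satisfies a backward recursion, whose
   coefficients are found by convolution: the density, distribution function and
   expected positive part (t - S)^+ of a partial sum S of service times solve
   linear differential equations, and so do the sums of exponentials in f, g, p.
   On a sample path, the cost is the sum of the idle periods before each arrival
   and of the waiting times, which splits into one term per interarrival period.
   The infimum over policies obeys the same recursion, because choosing an almost
   optimal interarrival time in every state gives a policy that is almost optimal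
   from every state. *)
Require Import Defs.
From HB Require Import structures.
From mathcomp Require Import all_boot all_order all_algebra.
From mathcomp Require Import all_classical all_reals all_analysis.
From mathcomp Require Import measurable_realfun ring lra zify.
Import Order.TTheory GRing.Theory Num.Theory.
Import numFieldNormedType.Exports.
Local Open Scope classical_set_scope.
Local Open Scope ring_scope.
Set Implicit Arguments.
Unset Strict Implicit.
Unset Printing Implicit Defensive.

(** * Exponential distribution *)

(** The state recursion stays on one fixed space: instead of shortening the vector of service times,
    one coordinate is overwritten by a residual time and earlier coordinates are ignored, so the
    same law serves at every arrival. All properties of the coefficients rest on two facts,
    [coef_step] and [sum_coef]. They give differential equations in which the same rate multiplies
    the forcing term and the unknown; such an equation characterises convolution with an exponential
    density, so no integral is evaluated coefficient by coefficient. The obstacle in C_i(k) is the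
    conditioning event, whose probability depends on the decisions before client i. Running the
    chain of states from client 1, the expected cost on the event becomes a product, the probability
    of reaching the state times the value from there, and the quotient leaves the value alone. A
    policy must also make the event possible, hence the strict positivity of transition
    probabilities. The path rules describe a queue only when service times are positive, which holds
    outside a null event. *)

Section integral_density.
Context d (T : measurableType d) (R : realType).
Variables (mu nu : {measure set T -> \bar R}) (g : T -> \bar R).
Hypothesis g_ge0 : forall x, (0 <= g x)%E.
Hypothesis g_fin : forall x, g x \is a fin_num.
Hypothesis mg : measurable_fun setT g.
Hypothesis nuE : forall A, measurable A -> nu A = (\int[mu]_(x in A) g x)%E.

Import HBNNSimple.

Lemma integral_density (w : T -> \bar R) :
  measurable_fun setT w -> (forall x, 0 <= w x)%E ->
  (\int[nu]_x w x = \int[mu]_x (w x * g x))%E.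
Proof.
move=> mw w0.
pose h := nnsfun_approx measurableT mw.
have -> : (\int[nu]_x w x = lim (\int[nu]_x (EFin \o h n) x @[n --> \oo]))%E.
  have fE x : w x = lim ((EFin \o h n) x @[n --> \oo]).
    by apply/esym/cvg_lim => //; exact: cvg_nnsfun_approx.
  under eq_integral do rewrite fE.
  apply: monotone_convergence => //.
  - by move=> n; exact/measurable_EFinP.
  - by move=> n x _; rewrite lee_fin.
  - by move=> x _ a b ab; rewrite lee_fin; exact/lefP/nd_nnsfun_approx.
have -> : (\int[mu]_x (w x * g x) =
    lim (\int[mu]_x ((EFin \o h n) x * g x) @[n --> \oo]))%E.
  have fg x : (w x * g x)%E = lim ((((EFin \o h n) \* g)%E x) @[n --> \oo]).
    by apply/esym/cvg_lim => //; apply: cvgeZr => //; exact: cvg_nnsfun_approx.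
  under eq_integral do rewrite fg.
  apply: monotone_convergence => //.
  - by move=> n; apply: emeasurable_funM => //; exact/measurable_EFinP.
  - by move=> n x _ /=; rewrite mule_ge0 ?lee_fin.
  - by move=> x _ a b ab/=; rewrite lee_wpmul2r// lee_fin; exact/lefP/nd_nnsfun_approx.
suff suf n : (\int[mu]_x ((EFin \o h n) x * g x) = \int[nu]_x (EFin \o h n) x)%E.
  by under [in RHS]eq_fun do rewrite suf.
transitivity (\int[nu]_x
   (\sum_(y \in range (h n)) (y * \1_(h n @^-1` [set y]) x)%:E))%E; last first.
  by apply: eq_integral => t tE; rewrite /= fimfunE -fsumEFin.
have indich m r : measurable_fun setT (fun x => (r * \1_(h m @^-1` [set r]) x)%:E).
  by apply: (measurable_comp measurableT) => //; exact: measurable_funM.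
rewrite ge0_integral_fsum//; last by move=> y x _; exact: nnfun_muleindic_ge0.
transitivity (\int[mu]_x (\sum_(y \in range (h n))
    (y * \1_(h n @^-1` [set y]) x)%:E * g x))%E.
  apply: eq_integral => x _.
  rewrite -ge0_mule_fsuml; last by move=> y; exact: nnfun_muleindic_ge0.
  by rewrite fsumEFin // -(fimfunE _ x).
rewrite ge0_integral_fsum//; last 2 first.
  - by move=> y; exact: emeasurable_funM.
  - by move=> m y _; rewrite mule_ge0// nnfun_muleindic_ge0.
apply: eq_fsbigr => r rhn.
under [RHS]eq_integral do rewrite EFinM.
rewrite integralZl_indic_nnsfun//.
under eq_integral do rewrite EFinM -muleA.
have mhr : measurable (h n @^-1` [set r]) by exact: measurable_funPTI.
rewrite ge0_integralZl//.
- under eq_integral do rewrite muleC.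
  rewrite (eq_integral (g \_ (h n @^-1` [set r]))%E); last first.
    by move=> x xE; rewrite epatch_indic.
  by rewrite -integral_mkcond -nuE// integral_indic// setIT.
- by apply: emeasurable_funM => //; exact/measurable_EFinP.
- by move=> t _; rewrite mule_ge0 ?lee_fin.
- by move: rhn; rewrite inE => -[t _ <-]; rewrite lee_fin.
Qed.

End integral_density.

Section exponential_law.
Context (R : realType) (M : R) (E : probability (R) R).
Hypothesis M_gt0 : 0 < M.
Hypothesis E_exp : forall A : set R, measurable A -> E A = exponential_prob M A.

Lemma exp_law_tail (x : R) : 0 <= x -> E `]x, +oo[%classic = (expR (- M * x))%:E.
Proof.
move=> x0.
rewrite -(@setCitvl _ _ (BRight x)) (probability_setC E)//.
suff -> : E `]-oo, x]%classic = (1 - (expR (- M * x))%:E)%E.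
  by rewrite -!EFinB; congr EFin; ring.
rewrite E_exp//.
have -> : exponential_prob M `]-oo, x] = exponential_prob M `[0, x].
  rewrite /exponential_prob integral_mkcond [RHS]integral_mkcond.
  apply: eq_integral => y _; rewrite !patchE !mem_setE !in_itv/=.
  case: (leP 0 y) => y0 //=.
  by rewrite lt0_exponential_pdf//; case: ifP.
move: x0; rewrite le_eqVlt => /predU1P[<-|x0].
  by rewrite /exponential_prob set_itv1 integral_set1 mulr0 expR0 subee.
exact: exponential_prob_itv0c.
Qed.

Lemma exp_law_le0 : E `]-oo, 0%R]%classic = 0%E.
Proof.
rewrite -(@setCitvr _ _ (BRight 0%R)) (probability_setC E)//.
by rewrite exp_law_tail// mulr0 expR0 subee.
Qed.

Lemma exp_law_eq_integral (h h' : R -> \bar R) :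
  measurable_fun setT h -> measurable_fun setT h' ->
  (forall x, 0 <= h x)%E -> (forall x, 0 <= h' x)%E ->
  (forall x, 0 < x -> h x = h' x) -> (\int[E]_x h x = \int[E]_x h' x)%E.
Proof.
move=> mh mh' h0 h'0 hh'; apply: ge0_ae_eq_integral => //.
exists `]-oo, 0%R]%classic; split; [exact: measurable_itv|exact: exp_law_le0|].
move=> x /= /not_implyP[_ hx]; rewrite in_itv/= leNgt; apply/negP => x0.
by apply: hx; exact: hh'.
Qed.

(** Restricted to the positive half-line, the shifted law and the law scaled by e^{-Mc} are finite
    measures that agree on all open rays by the tail formula, hence everywhere. The restriction
    discards the mass that the shift moves below 0. *)
Lemma exp_law_memoryless (c : R) (w : R -> \bar R) : 0 <= c ->
  measurable_fun setT w -> (forall x, 0 <= w x)%E ->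
  (\int[E]_x (if (c < x)%R then w (x - c)%R else 0) =
   (expR (- M * c))%:E * \int[E]_x w x)%E.
Proof.
move=> c0 mw w0.
pose D : set (R) := `]0, +oo[%classic.
have mD : measurable D by exact: measurable_itv.
pose sh (x : R) : R := x - c.
have msh : measurable_fun setT sh by exact: measurable_funB.
pose phi : {mfun R >-> R} :=
  HB.pack sh (isMeasurableFun.Build _ _ _ _ _ msh).
pose nu1 : {measure set (R) -> \bar R} :=
  mrestr (distribution E phi) mD.
pose nu2 : {measure set (R) -> \bar R} :=
  mscale (NngNum (expR_ge0 (- M * c))) (mrestr E mD).
have rayI (x : R) : `]x, +oo[%classic `&` D = `](Num.max x 0), +oo[%classic.
  by apply/seteqP; split => y /=; rewrite /D/= !in_itv/= !andbT gt_max => /andP.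
have phi_ray (x : R) : phi @^-1` `]x, +oo[%classic = `](c + x)%R, +oo[%classic.
  by rewrite eqEsubset; split => y /=; rewrite !in_itv/= !andbT ltrBrDl.
have nu12 A : measurable A -> nu1 A = nu2 A.
  apply: (measure_unique (@RGenOInfty.G R) (fun k => `](- k%:R), +oo[%classic)).
  - exact: RGenOInfty.measurableE.
  - move=> _ _ [x ->] [y ->]; exists (Num.max x y).
    by apply/seteqP; split => z /=; rewrite !in_itv/= !andbT gt_max => /andP.
  - by move=> k; exists (- k%:R).
  - rewrite -subTset => x _; exists (Num.truncn (- x)).+1 => //=.
    by rewrite in_itv/= andbT ltrNl truncnS_gt.
  - move=> _ [x ->]; rewrite /nu1 /nu2 /= /mscale /mrestr/= rayI /distribution.
    rewrite /pushforward phi_ray exp_law_tail ?addr_ge0 ?le_max ?lexx ?orbT//.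
    by rewrite /mrestr rayI exp_law_tail ?le_max ?lexx ?orbT// -EFinM -expRD mulrDr.
  - move=> k; rewrite /nu1 /= /mrestr rayI.
    by rewrite (le_lt_trans (probability_le1 _ _)) ?ltry//; exact: measurable_itv.
have -> : (\int[E]_x w x = \int[E]_(x in D) w x)%E.
  rewrite [RHS]integral_mkcond; apply: exp_law_eq_integral => //.
  - by apply/(measurable_restrictT _ mD) => //; exact: measurable_funTS.
  - by move=> x; apply: erestrict_ge0.
  - by move=> x x0; rewrite patchE mem_setE in_itv/= x0.
rewrite -[(expR (- M * c))%:E]/((NngNum (expR_ge0 (- M * c)))%:num%:E).
rewrite -ge0_integral_mscale//; last exact: measurable_funTS.
transitivity (\int[distribution E phi]_(x in D) w x)%E; last first.
  apply: eq_measure_integral => A mA AD.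
  have := nu12 A mA; rewrite /nu1 /nu2/= /mscale/= /mrestr/=.
  by rewrite (setIidl AD).
rewrite ge0_integral_pushforward//; last exact: measurable_funTS.
rewrite [RHS]integral_mkcond; apply: eq_integral => x _.
rewrite patchE /D phi_ray addr0.
by rewrite mem_setE in_itv/= andbT.
Qed.

Lemma integral_exp_law (w : R -> \bar R) :
  measurable_fun setT w -> (forall x, 0 <= w x)%E ->
  (\int[E]_x w x =
   \int[lebesgue_measure]_x (w x * (exponential_pdf M x)%:E))%E.
Proof.
move=> mw w0.
(* The identity carries [E] to the copy of the reals on which the density is integrated. *)
pose idT : R -> measurableTypeR R := idfun.
have mid : measurable_fun setT idT by move=> _ A mA; rewrite setTI.
pose idm : {mfun R >-> measurableTypeR R} :=
  HB.pack idT (isMeasurableFun.Build _ _ _ _ _ mid).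
have mw' : measurable_fun [set: measurableTypeR R] w by exact: mw.
transitivity (\int[distribution E idm]_x w x)%E.
  by rewrite ge0_integral_pushforward.
apply: integral_density => //.
- by move=> x; rewrite lee_fin exponential_pdf_ge0// ltW.
- by apply/measurable_EFinP; exact: measurable_exponential_pdf.
Qed.

(** Variation of constants: the solution of y' = M (w - y) with y 0 = 0 is the convolution of w with
    the exponential density. A candidate formula can thus be checked by differentiation. The
    absolute values match [psum]. *)
Lemma exp_law_convolution (w y : R -> R) (t : R) : 0 <= t ->
  continuous w -> (forall s, 0 <= s -> 0 <= w s) -> y 0 = 0 ->
  (forall s : R, is_derive s 1 y (M * (w s - y s))) ->
  (\int[E]_x (if (`|x| <= t)%R then (w (t - `|x|))%:E else 0) = (y t)%:E)%E.
Proof.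
move=> t0 cw w0 y0 dy.
pose h (x : R) := if 0 <= x <= t then (w (t - x))%:E else 0%E.
have mh : measurable_fun setT h.
  apply: measurable_fun_if => //.
  - apply: (@measurable_fun_bool _ _ _ _ true); rewrite setTI.
    have -> : (fun x : R => 0 <= x <= t) @^-1` [set true] = `[0, t]%classic.
      by apply/seteqP; split => x /=; rewrite in_itv/=.
    exact: measurable_itv.
  - apply: measurable_funTS; apply/measurable_EFinP.
    apply: continuous_measurable_fun => x; apply: continuous_comp; last exact: cw.
    by apply: (@continuousB _ R^o); [exact: cst_continuous|exact: id].
have h0 x : (0 <= h x)%E.
  rewrite /h; case: ifP => // /andP[x0 xt]; rewrite lee_fin w0// subr_ge0//.
pose k (x : R) := if `|x| <= t then (w (t - `|x|))%:E else 0%E.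
have kE x : k x = h `|x| by rewrite /k /h normr_ge0.
have mk : measurable_fun setT k.
  have -> : k = h \o Num.norm by apply/funext => x; exact: kE.
  by apply: measurableT_comp => //; exact: normr_measurable.
transitivity (\int[E]_x h x)%E.
  apply: exp_law_eq_integral => //; first by move=> x; rewrite -/(k x) kE.
  by move=> x x0; rewrite -/(k x) kE gtr0_norm.
rewrite integral_exp_law//.
transitivity (\int[lebesgue_measure]_(x in `[0%R, t]) (w (t - x) * (M * expR (- M * x)))%:E)%E.
  rewrite [RHS]integral_mkcond; apply: eq_integral => x _; rewrite patchE mem_setE in_itv/= /h.
  case: ifP => [/andP[x0 xt]|_]; last by rewrite mul0e.
  by rewrite exponential_pdfE.
move: t0; rewrite le_eqVlt => /predU1P[<-|t0].
  by rewrite set_itv1 integral_set1 y0.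
(* An antiderivative of the integrand: by the differential equation the two terms with y (t - x)
   cancel. *)
pose F x := - (expR (- M * x) * y (t - x)).
have dF (x : R) : is_derive x 1 F (w (t - x) * (M * expR (- M * x))).
  have dyt : is_derive x 1 (fun x => y (t - x)) (- (M * (w (t - x) - y (t - x)))).
    have dtx : is_derive x 1 (fun x => t - x) (-1).
      by have := is_deriveB (is_derive_cst t x 1) (is_derive_id x 1); rewrite sub0r.
    have := @is_derive1_comp R y (fun x => t - x) x _ _ (dy (t - x)) dtx.
    by rewrite mulrN1.
  have de : is_derive x 1 (fun x => expR (- M * x)) (- M * expR (- M * x)).
    have dMx : is_derive x 1 (fun x => - M * x) (- M).
      by have := is_deriveZ (- M) (is_derive_id x 1); rewrite /GRing.scale/= mulr1.
    have := @is_derive1_comp R expR (fun x => - M * x) x _ _ (is_derive_expR (- M * x)) dMx.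
    by rewrite mulrC.
  apply: is_derive_eq.
  rewrite /GRing.scale /=; ring.
have cF (x : R) : {for x, continuous F} by apply: differentiable_continuous;
  apply/derivable1_diffP; exact: (ex_derive (is_derive := dF x)).
have cG : continuous (fun x : R => w (t - x) * (M * expR (- M * x)) : R).
  move=> x.
  have c1 : {for x, continuous (fun x : R => w (t - x) : R)}.
    apply: continuous_comp; last exact: cw.
    by apply: (@continuousB _ R^o); [exact: cst_continuous|exact: id].
  have c2 : {for x, continuous (fun x : R => expR (- M * x) : R)}.
    apply: continuous_comp; last exact: continuous_expR.
    by apply: mulrl_continuous.
  by apply: cvgM => //; apply: cvgM => //; exact: cvg_cst.
rewrite (continuous_FTC2 (F := F))//.
- by rewrite -EFinB; congr EFin; rewrite /F subrr y0 !mulr0 subr0 expR0 mul1r; ring.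
- exact: (continuous_subspaceT cG).
- split.
  + by move=> z _; exact: (ex_derive (is_derive := dF z)).
  + by apply/cvg_at_right_filter; exact: cF.
  + by apply/cvg_at_left_filter; exact: cF.
- move=> x _; rewrite derive1E; exact: (derive_val (is_derive := dF x)).
Qed.

(** The mean is the integral of the tail, and on the nonnegative half-line the tail is M^-1 times
    the density. *)
Lemma exp_law_mean : (\int[E]_x `|x|%:E = M^-1%:E)%E.
Proof.
have mn : measurable_fun setT (@Num.norm R R : R -> R) by exact: normr_measurable.
have mX (x : R) : measurable (@Num.norm R R @^-1` `]x, +oo[%classic).
  by rewrite -[X in measurable X]setTI; exact: mn.
pose X : {RV E >-> R} := HB.pack (@Num.norm R R : R -> R) (isMeasurableFun.Build _ _ _ _ _ mn).
have := @ge0_expectation_ccdf _ _ _ E X (fun x => normr_ge0 x).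
rewrite unlock /= => ->.
transitivity (\int[lebesgue_measure]_x ((M^-1)%:E * (exponential_pdf M x)%:E))%E; last first.
  rewrite ge0_integralZl//.
  - by rewrite integral_exponential_pdf// mule1.
  - by apply/measurable_EFinP; exact: measurable_exponential_pdf.
  - by move=> x _; rewrite lee_fin exponential_pdf_ge0// ltW.
  - by rewrite lee_fin invr_ge0 ltW.
rewrite integral_mkcond; apply: eq_integral => x _; rewrite patchE mem_setE in_itv/= andbT.
case: (leP 0 x) => x0; last by rewrite lt0_exponential_pdf// mule0.
rewrite exponential_pdfE// -EFinM mulKf ?gt_eqF//.
rewrite -(exp_law_tail x0) /ccdf /distribution /pushforward.
rewrite -[X @^-1` _]setIT -[in RHS](setIT `]x, +oo[%classic) -!integral_indic//.
apply: exp_law_eq_integral.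
- exact/measurable_EFinP/measurable_indic.
- exact/measurable_EFinP/measurable_indic.
- by move=> z; rewrite lee_fin.
- by move=> z; rewrite lee_fin.
move=> z z0; rewrite !indicE; congr (_%:R%:E); congr nat_of_bool.
have -> : (z \in X @^-1` `]x, +oo[%classic) = (`|z| \in `]x, +oo[%classic) by [].
by rewrite gtr0_norm.
Qed.

End exponential_law.

(** * Sums of exponentials with distinct rates *)

Lemma is_derive_expM (R : realType) (a t : R) : is_derive t 1 (fun t =>
  expR (a * t)) (a * expR (a * t)).
Proof.
have daM : is_derive t 1 (fun x => a * x) a.
  by have := is_deriveZ a (is_derive_id t 1); rewrite /GRing.scale/= mulr1.
have := @is_derive1_comp R expR (fun x => a * x) t _ _ (is_derive_expR (a * t)) daM.
by rewrite mulrC.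
Qed.

Lemma is_derive_bigsum (R : realType) (I : Type) (r : seq I) (F : I -> R -> R) (dF : I ->
  R) (t : R) :
  (forall i : I, is_derive t 1 (F i) (dF i)) ->
  is_derive t 1 (fun t => \sum_(i <- r) F i t) (\sum_(i <- r) dF i).
Proof.
move=> h; elim: r => [|i r IH].
  rewrite big_nil (_ : (fun t => _) = cst 0); first exact: is_derive_cst.
  by apply/funext => s; rewrite big_nil.
rewrite big_cons (_ : (fun t => _) = F i \+ (fun t => \sum_(i <- r) F i t)).
  exact: is_deriveD.
by apply/funext => s; rewrite big_cons.
Qed.

Lemma cvg_sum_seq (R : realType) (I : eqType) (r : seq I) (F : I -> R -> R) (l : I -> R)
    (T : set_system R) {FT : Filter T} :
  (forall i : I, i \in r -> F i t @[t --> T] --> l i) ->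
  \sum_(i <- r) F i t @[t --> T] --> \sum_(i <- r) l i.
Proof.
elim: r => [|i r IH] h.
  by rewrite big_nil; under eq_fun do rewrite big_nil; exact: cvg_cst.
rewrite big_cons; under eq_fun do rewrite big_cons.
apply: cvgD; first by apply: h; rewrite mem_head.
by apply: IH => j jr; apply: h; rewrite inE jr orbT.
Qed.

Section coefficients.
Context (R : realType) (mu : nat -> R).
Implicit Types (k l m i j : nat) (t : R).

Lemma coef_out k l j : (k + l < j)%N -> coef mu k l j = 0.
Proof.
elim: l j => [|l IH] j klj /=; first by rewrite ifN//; lia.
by rewrite ifN ?IH ?mul0r//; lia.
Qed.

(* [sumcdf k m] is the distribution function of a sum of independent
   exponential variables S with rates mu k, ..., mu (k + m - 1), and
   [slack k m t] is the expectation of the positive part of t - S. *)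
Definition sumcdf k m t : R :=
  if m is l.+1 then
    1 - \sum_(k <= j < (k + l).+1) coef mu k l j / mu j * expR (- mu j * t)
  else 1.

Definition slack k m t : R :=
  if m is l.+1 then
    t - \sum_(k <= j < (k + l).+1) coef mu k l j / mu j * psi mu j t
  else t.

Lemma f_slack k i t : (1 <= k <= i)%N -> f mu k i t = slack (i - k).+1 k t.
Proof.
case: k => // k /andP[_ ki]; rewrite /f /slack /=.
by congr (_ - \sum_(_ <= j < _) _); lia.
Qed.

Definition distinct_rates k l := forall j, (k <= j <= k + l)%N ->
  0 < mu j /\ forall j', (k <= j' <= k + l)%N -> mu j = mu j' -> j = j'.

Section distinct_rates.
Variable k : nat.
Let good l := distinct_rates k l.

Let goodW l : good l.+1 -> good l.
Proof.
move=> gl j jl; have [|-> h] := gl j; first lia.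
by split=> // j' j'l; apply: h; lia.
Qed.

(** Below the top index this is the recursion with its denominator cleared, divided by both rates;
    at the top index the last coefficient is 0. Summed against exponentials or [psi], it gives the
    recursions in l for [sumcdf] and [slack]. *)
Lemma coef_step l j : good l.+1 -> (k <= j <= k + l.+1)%N ->
  coef mu k l.+1 j / mu (k + l.+1)%N = coef mu k l.+1 j / mu j - coef mu k l j / mu j.
Proof.
move=> gl jl; have [mj dj] := gl j jl.
have [|mM dM] := gl (k + l.+1)%N; first lia.
have [->|jn] := eqVneq j (k + l.+1)%N;
  first by rewrite (coef_out (k := k) (l := l)) ?mul0r ?subr0//; lia.
rewrite /= ifN//.
have : mu (k + l.+1)%N - mu j != 0.
  by rewrite subr_eq0; apply: contra_neq jn => /esym; apply: dj; lia.
by move=> d0; field; rewrite d0 !gt_eqF.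
Qed.

(** The top coefficient is by definition minus the sum of the others: the density of a sum of at
    least two exponential variables vanishes at 0. *)
Lemma sum_coef l : good l.+1 -> \sum_(k <= j < (k + l.+1).+1) coef mu k l.+1 j = 0.
Proof.
move=> gl; rewrite big_nat_recr/=; last lia.
rewrite eqxx -big_split/= big1_seq// => j /andP[_]; rewrite mem_index_iota => jl.
rewrite ifN; last lia.
have d0 : mu (k + l.+1)%N - mu j != 0.
  rewrite subr_eq0; apply/eqP => /(proj2 (gl (k + l.+1)%N _)); lia.
have d1 : mu j - mu (k + l.+1)%N != 0 by rewrite -opprB oppr_eq0.
by field; rewrite d0 d1.
Qed.

(** The density has total mass 1. By [coef_step] the sum changes with l by a multiple of the sum of
    all coefficients, which is 0. *)
Lemma sum_coef_div l : good l -> \sum_(k <= j < (k + l).+1) coef mu k l j / mu j = 1.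
Proof.
elim: l => [|l IH] gl.
  rewrite addn0 big_nat1 /= eqxx divff// gt_eqF//.
  by apply: (gl k _).1; lia.
rewrite (eq_big_nat _ _ (F2 := fun j =>
  coef mu k l.+1 j / mu (k + l.+1)%N + coef mu k l j / mu j)); last first.
  by move=> j jl; rewrite coef_step ?subrK//; lia.
rewrite big_split/= -mulr_suml sum_coef// mul0r add0r big_nat_recr/=; last lia.
rewrite [in X in _ + X]coef_out ?mul0r ?addr0; last lia.
by rewrite addnS; apply: IH; exact: goodW.
Qed.

Lemma sum_coef_step l (F : nat -> R) : good l.+1 ->
  \sum_(k <= j < (k + l.+1).+1) coef mu k l.+1 j / mu (k + l.+1)%N * F j =
  \sum_(k <= j < (k + l.+1).+1) coef mu k l.+1 j / mu j * F j -
  \sum_(k <= j < (k + l).+1) coef mu k l j / mu j * F j.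
Proof.
move=> gl.
have -> : \sum_(k <= j < (k + l).+1) coef mu k l j / mu j * F j =
    \sum_(k <= j < (k + l.+1).+1) coef mu k l j / mu j * F j.
  rewrite [RHS]big_nat_recr/=; last lia.
  by rewrite [in X in _ + X]coef_out ?mul0r ?addr0 ?addnS//; lia.
rewrite -sumrB; apply: eq_big_nat => j jl.
by rewrite coef_step -?mulrBl//; lia.
Qed.

(** Both sides are the probability that client k + l is in service at time t when client k starts at
    time 0. *)
Lemma sumcdf_sub l t : good l ->
  sumcdf k l t - sumcdf k l.+1 t = phi mu k l t / mu (k + l)%N.
Proof.
case: l => [|l] gl; rewrite /sumcdf /phi.
  by rewrite addn0 !big_nat1/=; ring.
rewrite [RHS]mulr_suml.
under [RHS]eq_bigr do rewrite mulrAC.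
by rewrite (sum_coef_step (fun j => expR (- mu j * t)))//; ring.
Qed.

Lemma slack_sub l t : good l ->
  slack k l t - slack k l.+1 t =
  \sum_(k <= j < (k + l).+1) coef mu k l j / mu (k + l)%N * psi mu j t.
Proof.
case: l => [|l] gl; rewrite /slack; first by rewrite addn0 !big_nat1; ring.
by rewrite (sum_coef_step (fun j => psi mu j t))//; ring.
Qed.

(** For X exponential of rate M, E min(X, a) = P(X <= a) / M. Since [sumcdf] is the derivative of
    [slack], this gives [slack] an equation of the form required by [exp_law_convolution]. *)
Lemma slack_sub_sumcdf l t : good l ->
  slack k l t - slack k l.+1 t = sumcdf k l.+1 t / mu (k + l)%N.
Proof.
move=> gl; rewrite slack_sub// /sumcdf -(sum_coef_div gl) -sumrB mulr_suml.
apply: eq_big_nat => j jl; rewrite /psi; have [mj _] := gl j jl.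
have [|mM _] := gl (k + l)%N; first lia.
by field; rewrite !gt_eqF.
Qed.

Lemma sumcdf0 l : good l -> sumcdf k l.+1 0 = 0.
Proof.
move=> gl; rewrite /sumcdf -(sum_coef_div gl) -sumrB big1// => j _.
by rewrite mulr0 expR0 mulr1 subrr.
Qed.

Lemma slack0 m : slack k m 0 = 0.
Proof.
case: m => // l; rewrite /slack big1 ?subr0// => j _.
by rewrite /psi mulr0 expR0 subrr mul0r mulr0.
Qed.

Lemma is_derive_sumcdf l t : good l ->
  is_derive t 1 (sumcdf k l.+1) (mu (k + l)%N * (sumcdf k l t - sumcdf k l.+1 t)).
Proof.
move=> gl; rewrite sumcdf_sub//.
rewrite mulrCA divff ?mulr1; last by rewrite gt_eqF//; apply: (gl _ _).1; lia.
have := is_deriveB (is_derive_cst (1 : R) t 1)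
  (@is_derive_bigsum R _ (index_iota k (k + l).+1) (fun j t =>
    coef mu k l j / mu j * expR (- mu j * t)) _ t
    (fun j => is_deriveZ (coef mu k l j / mu j) (is_derive_expM (- mu j) t))).
rewrite sub0r (_ : - _ = phi mu k l t)//.
rewrite /phi -sumrN; apply: eq_big_nat => j jl; rewrite /GRing.scale/=.
have [mj _] := gl j jl.
by field; rewrite gt_eqF.
Qed.

Lemma is_derive_slack m t : (if m is l.+1 then good l else True) ->
  is_derive t 1 (slack k m) (sumcdf k m t).
Proof.
case: m => [_|l gl]; first exact: is_derive_id.
have dpsi j : is_derive t 1 (psi mu j) ((mu j)^-1 * (mu j * expR (- mu j * t))).
  have := is_deriveZ (mu j)^-1 (is_deriveB (is_derive_cst (1 : R) t 1) (is_derive_expM (-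
    mu j) t)).
  rewrite /GRing.scale/= sub0r mulNr opprK.
  by rewrite (_ : _ \*: _ = psi mu j)//; apply/funext => s; rewrite /psi/= mulrC.
have := is_deriveB (is_derive_id t 1)
  (@is_derive_bigsum R _ (index_iota k (k + l).+1) (fun j t =>
    coef mu k l j / mu j * psi mu j t) _ t
    (fun j => is_deriveZ (coef mu k l j / mu j) (dpsi j))).
rewrite (_ : _ - _ = sumcdf k l.+1 t)//.
rewrite /sumcdf; congr (_ - _); apply: eq_big_nat => j jl; rewrite /GRing.scale/=.
have [mj _] := gl j jl.
by field; rewrite gt_eqF.
Qed.

Lemma is_derive_slackS l t : good l ->
  is_derive t 1 (slack k l.+1) (mu (k + l)%N * (slack k l t - slack k l.+1 t)).
Proof.
move=> gl; rewrite slack_sub_sumcdf// mulrCA divff ?mulr1; last first.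
  by rewrite gt_eqF//; apply: (gl _ _).1; lia.
exact: is_derive_slack.
Qed.

Lemma continuous_sumcdf m : (if m is l.+1 then good l else True) -> continuous (sumcdf k m).
Proof.
case: m => [_|l gl] t; first exact: cst_continuous.
apply: differentiable_continuous; apply/derivable1_diffP.
exact: (ex_derive (is_derive := is_derive_sumcdf t gl)).
Qed.

Lemma continuous_slack m : (if m is l.+1 then good l else True) -> continuous (slack k m).
Proof.
move=> gl t; apply: differentiable_continuous; apply/derivable1_diffP.
exact: (ex_derive (is_derive := is_derive_slack t gl)).
Qed.

End distinct_rates.

(** Summation by parts: k - l - 1 counts the indices strictly between l and k. Each term on the
    right is the mean of the minimum of t and a partial sum, the time that one client spends
    waiting. *)
Lemma g_slack k i t : (1 <= k <= i)%N -> distinct_rates (i - k).+1 k.-1 ->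
  g mu k i t = \sum_(1 <= l < k) (t - slack (i - k).+1 l t).
Proof.
move=> ki good; rewrite /g.
have step l : (l < k)%N -> \sum_((i - k).+1 <= j < (i - k + l + 1).+1)
      coef mu (i - k).+1 l j / mu (i - k + l + 1)%N * psi mu j t =
    slack (i - k).+1 l t - slack (i - k).+1 l.+1 t.
  move=> lk; rewrite slack_sub.
    by rewrite addn1 addSn.
  move=> j jl; have [|mj dj] := good j; first lia.
  by split=> // j' j'l; apply: dj; lia.
rewrite (eq_big_nat _ _ (F2 := fun l =>
  (k - l - 1)%:R * (slack (i - k).+1 l t - slack (i - k).+1 l.+1 t))); last first.
  by move=> l /andP[_ lk]; rewrite step.
have : slack (i - k).+1 0 t = t by [].
move: (slack (i - k).+1) => s s0 {step good}.
have {ki} : (1 <= k)%N by lia.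
elim: k => // -[|k] IH _; first by rewrite big_nat1 big_geq// mul0r.
rewrite [RHS]big_nat_recr//= -IH// big_nat_recr//= subSn// subnn mul0r addr0.
transitivity (\sum_(0 <= l < k.+1) (((k.+1 - l - 1)%:R * (s l t - s l.+1 t)) + (s l t - s
  l.+1 t))).
  apply: eq_big_nat => l lk; rewrite (_ : (k.+2 - l - 1 = (k.+1 - l - 1).+1)%N); last lia.
  by rewrite -natr1 mulrDl mul1r.
rewrite big_split/=; congr (_ + _).
under eq_bigr do rewrite -opprB.
by rewrite sumrN telescope_sumr// opprB s0.
Qed.

Lemma p_ge2_sumcdf k l i t : (2 <= l <= k.+1)%N -> (k <= i)%N ->
  distinct_rates (i - k).+1 k.-1 ->
  p_ge2 mu k l i t = sumcdf (i - k).+1 (k + 1 - l) t - sumcdf (i - k).+1 (k + 2 - l) t.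
Proof.
move=> lk ki good; rewrite (_ : k + 2 - l = (k + 1 - l).+1)%N; last lia.
rewrite sumcdf_sub /p_ge2; first by congr (_ / mu _); lia.
move=> j jl; have [|mj dj] := good j; first lia.
by split=> // j' j'l; apply: dj; lia.
Qed.

(** The sum in the complement telescopes, starting from the empty sum of service times, whose
    distribution function is 1. *)
Lemma p1_sumcdf k i t : (1 <= k <= i)%N -> distinct_rates (i - k).+1 k.-1 ->
  p mu k 1 i t = sumcdf (i - k).+1 k t.
Proof.
move=> ki good; rewrite /p eqxx.
rewrite (eq_big_nat _ _ (F2 := fun l =>
  sumcdf (i - k).+1 (k + 1 - l) t - sumcdf (i - k).+1 (k + 2 - l) t)); last first.
  by move=> l lk; rewrite p_ge2_sumcdf//; lia.
rewrite (eq_big_nat _ _ (F2 := fun l =>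
  sumcdf (i - k).+1 (k + 2 - l.+1) t - sumcdf (i - k).+1 (k + 2 - l) t)); last first.
  by move=> l lk; congr (sumcdf _ _ _ - _); lia.
rewrite (telescope_sumr (fun l => sumcdf (i - k).+1 (k + 2 - l) t)); last lia.
have -> : (k + 2 - k.+2 = 0)%N by lia.
by rewrite addnK [sumcdf _ 0 t]/= opprB addrC subrK.
Qed.

(** Each [psi] tends to the inverse rate, and [sum_coef_div] collapses every inner sum to the mean
    of one service time. *)
Lemma cvg_g k n : (1 <= k <= n)%N -> distinct_rates (n - k).+1 k.-1 ->
  g mu k n t @[t --> +oo] -->
  \sum_(0 <= l < k) (k - l - 1)%:R * (mu (n - k + l + 1)%N)^-1.
Proof.
move=> kn good; rewrite /g.
have -> : \sum_(0 <= l < k) (k - l - 1)%:R * (mu (n - k + l + 1)%N)^-1 =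
   \sum_(0 <= l < k) (k - l - 1)%:R * \sum_((n - k).+1 <= j < (n - k + l + 1).+1)
        (coef mu (n - k).+1 l j / mu (n - k + l + 1)%N * (mu j)^-1).
  apply: eq_big_nat => l lk; congr (_ * _).
  under eq_bigr do rewrite mulrAC.
  rewrite -mulr_suml (_ : (n - k + l + 1).+1 = ((n - k).+1 + l).+1)%N; last lia.
  rewrite sum_coef_div ?mul1r// => j jl; have [|mj dj] := good j; first lia.
  by split=> // j' j'l; apply: dj; lia.
have psi_cvg j : (n - k < j < n.+1)%N -> psi mu j t @[t --> +oo] --> (mu j)^-1.
  move=> jn; rewrite /psi; suff : (1 - expR (- mu j * t)) / mu j @[t --> +oo] --> (1 - 0) /
    mu j.
    by rewrite subr0 mul1r.
  apply: cvgM; last exact: cvg_cst.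
  apply: cvgB; first exact: cvg_cst.
  have [|mj _] := good j; first lia.
  rewrite (_ : (fun t => expR (- mu j * t)) = (fun z => expR (- z)) \o (fun z =>
    mu j * z)); last first.
    by apply/funext => z /=; rewrite mulNr.
  apply: (@cvg_comp _ _ _ _ _ _ (pinfty_nbhs R)); last exact: cvgr_expR.
  exact: gt0_cvgMry.
apply: cvg_sum_seq => l; rewrite mem_index_iota => lk.
apply: cvgM; first exact: cvg_cst.
apply: cvg_sum_seq => j; rewrite mem_index_iota => jl.
by apply: cvgM; [exact: cvg_cst|apply: psi_cvg; lia].
Qed.

End coefficients.

(** * Product law of the service times *)

Section services.
Context (R : realType) (n : nat).
Implicit Types (A : nat -> set R) (b : nat -> R) (j q : nat).

Definition cylinder A : set (nat -> R) := [set b | forall j, (1 <= j <= n)%N -> A j (b j)].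

Definition cylinders : set (set (nat -> R)) :=
  [set C | exists2 A, (forall j, measurable (A j)) & C = cylinder A].

(** Vectors are functions on all of nat, but the sigma-algebra sees only the coordinates 1, ..., n,
    the only ones with a prescribed law. *)
Definition services : measurableType (cylinders).-sigma := g_sigma_algebraType cylinders.

Lemma cylinders_setI : setI_closed cylinders.
Proof.
move=> _ _ [A mA ->] [A' mA' ->]; exists (fun j => A j `&` A' j).
  by move=> j; exact: measurableI.
apply/seteqP; split => b /=; first by move=> [h h'] j jn; split; [exact: h|exact: h'].
by move=> h; split=> j jn; have [] := h j jn.
Qed.

Lemma cylindersT : cylinders setT.
Proof. by exists (fun=> setT) => //; apply/seteqP; split. Qed.

Lemma measurable_cylinder A : (forall j, measurable (A j)) ->
  measurable (cylinder A : set services).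
Proof. by move=> mA; apply: sub_gen_smallest; exists A. Qed.

Lemma measurable_coord j : (1 <= j <= n)%N ->
  measurable_fun setT (fun b : services => b j : R).
Proof.
move=> jn _ A mA; rewrite setTI.
rewrite (_ : _ @^-1` A = cylinder (fun i => if i == j then A else setT)).
  by apply: measurable_cylinder => i; case: ifP.
apply/seteqP; split => b /=; last by move=> /(_ j jn); rewrite eqxx.
by move=> h i _; case: eqP => // ->.
Qed.

Lemma measurable_fun_services d (T : measurableType d) (D : set T) (f : T -> services) :
  measurable D ->
  (forall j, (1 <= j <= n)%N -> measurable_fun D (fun x => f x j : R)) ->
  measurable_fun D f.
Proof.
move=> mD mf; apply: (@measurability _ _ T services D f cylinders) => //.
move=> _ [_ [A mA ->] <-].
have -> : f @^-1` cylinder A =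
    \bigcap_j (if (1 <= j <= n)%N then (fun x => f x j : R) @^-1` A j else setT).
  apply/seteqP; split => x /= h j; first by move=> _; case: ifP => // jn; exact: h.
  by move=> jn; have := h j I; rewrite jn.
have -> : D `&` \bigcap_j (if (1 <= j <= n)%N then (fun x => f x j : R) @^-1` A j else setT)
    = \bigcap_j (D `&` (if (1 <= j <= n)%N then (fun x => f x j : R) @^-1` A j else setT)).
  apply/seteqP; split => x /=; first by move=> [Dx h] j _; split => //; exact: h.
  by move=> h; split => [|j _]; [exact: (h 0%N I).1|exact: (h j I).2].
apply: bigcapT_measurable => j; case: ifP => jn; last by rewrite setIT.
exact: mf.
Qed.

Definition merge (S : pred nat) b b' : nat -> R := fun j => if S j then b' j else b j.

Definition upd b q (x : R) : nat -> R := fun j => if j == q then x else b j.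

Lemma measurable_merge S :
  measurable_fun setT (fun z : services * services => merge S z.1 z.2 : services).
Proof.
apply: measurable_fun_services => // j jn; rewrite /merge; case: (S j).
  exact: (measurableT_comp (measurable_coord jn)).
exact: (measurableT_comp (measurable_coord jn)).
Qed.

Lemma measurable_upd q :
  measurable_fun setT (fun z : services * R => upd z.1 q z.2 : services).
Proof.
apply: measurable_fun_services => // j jn; rewrite /upd; case: (j == q);
  first exact: measurable_snd.
exact: (measurableT_comp (measurable_coord jn)).
Qed.

Section product_law.
Variables (Q : probability services R) (E : nat -> probability R R).
Hypothesis Q_cyl : forall A, (forall j, measurable (A j)) ->
  Q (cylinder A) = (\prod_(j <- iota 1 n) E j (A j))%E.

Lemma prod_law_coord q (C : set R) : (1 <= q <= n)%N -> measurable C ->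
  Q [set b | C (b q)] = E q C.
Proof.
move=> qn mC; pose A j := if j == q then C else setT.
have -> : [set b | C (b q)] = cylinder A.
  apply/seteqP; split => b /=; last by move=> /(_ q qn); rewrite /A eqxx.
  by move=> h i _; rewrite /A; case: eqP => // ->.
rewrite Q_cyl; last by move=> j; rewrite /A; case: ifP.
rewrite (bigD1_seq q)/= ?iota_uniq// ?mem_iota; last lia.
rewrite {1}/A eqxx big1 ?mule1// => j jq.
by rewrite /A (negbTE jq) probability_setT.
Qed.

Lemma integral_coord q (w : R -> \bar R) : (1 <= q <= n)%N ->
  measurable_fun setT w -> (forall x, 0 <= w x)%E ->
  (\int[Q]_b w (b q) = \int[E q]_x w x)%E.
Proof.
move=> qn mw w0.
pose X : {mfun services >-> R} :=
  HB.pack (fun b : services => b q : R) (isMeasurableFun.Build _ _ _ _ _ (measurable_coord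
    qn)).
transitivity (\int[distribution Q X]_x w x)%E.
  by rewrite ge0_integral_pushforward//; exact: measurable_coord.
by apply: eq_measure_integral => C mC _; exact: (prod_law_coord qn mC).
Qed.

(** Taking some coordinates from an independent copy preserves a product law: on cylinders each
    coordinate contributes its factor in exactly one of two products. A single coordinate gives
    [integral_resample], a tail of coordinates [integral_indep]. *)
Lemma integral_merge S (h : services -> \bar R) :
  measurable_fun setT h -> (forall b, 0 <= h b)%E ->
  (\int[Q]_b \int[Q]_b' h (merge S b b') = \int[Q]_b h b)%E.
Proof.
move=> mh h0.
pose m (z : services * services) : services := merge S z.1 z.2.
have mm : measurable_fun setT m by exact: measurable_merge.
pose mf : {mfun (services * services)%type >-> services} :=
  HB.pack m (isMeasurableFun.Build _ _ _ _ _ mm).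
transitivity (\int[Q \x Q]_z (h \o m) z)%E.
  by rewrite fubini_tonelli1//; [exact: measurableT_comp|move=> z; exact: h0].
transitivity (\int[distribution (Q \x Q)%E mf]_b h b)%E.
  by rewrite ge0_integral_pushforward.
apply: eq_measure_integral => C mC _.
pose nu : {measure set services -> \bar R} := distribution (Q \x Q)%E mf.
apply: (@measure_unique _ _ services cylinders (fun=> setT) _ _ _ _ nu Q) => //.
- exact: cylinders_setI.
- by move=> _; exact: cylindersT.
- by rewrite bigcup_const//; exists 0%N.
- move=> _ [A mA ->]; rewrite /nu /= /distribution /pushforward.
  pose A1 j := if S j then setT else A j.
  pose A2 j := if S j then A j else setT.
  have mA1 j : measurable (A1 j) by rewrite /A1; case: ifP.
  have mA2 j : measurable (A2 j) by rewrite /A2; case: ifP.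
  have -> : m @^-1` cylinder A = (cylinder A1 : set services) `*` (cylinder A2 : set services).
    apply/seteqP; split => -[b b'] /=.
      by move=> h'; split => j jn; have := h' j jn; rewrite /m /merge /= /A1 /A2; case: (S j).
    by move=> [h1 h2] j jn; have := h1 j jn; have := h2 j jn; rewrite /m /merge /= /A1 /A2;
      case: (S j).
  rewrite product_measure1E; [|exact: measurable_cylinder..].
  transitivity ((\prod_(j <- iota 1 n) E j (A1 j)) * (\prod_(j <- iota 1 n) E j (A2 j)))%E.
    by congr (_ * _)%E; exact: Q_cyl.
  rewrite Q_cyl// -big_split/=; apply: eq_bigr => j _.
  by rewrite /A1 /A2; case: (S j); rewrite probability_setT ?mule1 ?mul1e.
- by move=> _; rewrite /nu /= /distribution /pushforward preimage_setT (le_lt_trans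
  (probability_le1 _ _)) ?ltry.
Qed.

Lemma integral_resample q (h : services -> \bar R) : (1 <= q <= n)%N ->
  measurable_fun setT h -> (forall b, 0 <= h b)%E ->
  (\int[Q]_b h b = \int[Q]_b \int[E q]_x h (upd b q x))%E.
Proof.
move=> qn mh h0; rewrite -(integral_merge (pred1 q))//.
apply: eq_integral => b _.
rewrite -(@integral_coord q (fun x => h (upd b q x)))//.
  apply: eq_integral => b' _; congr (h _); apply/funext => j.
  by rewrite /merge /upd/=; case: eqP => // ->.
apply: (measurableT_comp mh).
exact: (measurableT_comp (measurable_upd q) (pair1_measurable b)).
Qed.

Lemma integral_indep q (u w : services -> \bar R) :
  measurable_fun setT u -> measurable_fun setT w ->
  (forall b, 0 <= u b)%E -> (forall b, 0 <= w b)%E ->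
  (forall b b', (forall j, (j < q)%N -> b j = b' j) -> u b = u b') ->
  (forall b b', (forall j, (q <= j)%N -> b j = b' j) -> w b = w b') ->
  (\int[Q]_b (u b * w b) = \int[Q]_b u b * \int[Q]_b w b)%E.
Proof.
move=> mu mw u0 w0 uq wq.
rewrite -(integral_merge (leq q)); [|exact: emeasurable_funM|by move=> b; rewrite mule_ge0].
rewrite -ge0_integralZr//; last exact: integral_ge0.
apply: eq_integral => b _; rewrite -ge0_integralZl//.
apply: eq_integral => b' _; congr (_ * _)%E.
  by apply: uq => j jq; rewrite /merge leqNgt jq.
by apply: wq => j jq; rewrite /merge jq.
Qed.

End product_law.

End services.

(** * Partial sums of service times and their integrals *)

Section partial_sums.
Context (R : realType).
Implicit Types (b : nat -> R) (m l q : nat) (t : R).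

(* Absolute values make the partial sums monotone for all b; service times are
   almost surely positive. *)
Definition psum m l b : R := \sum_(m <= j < m + l) `|b j|.

Lemma psum0 m b : psum m 0 b = 0.
Proof. by rewrite /psum addn0 big_geq. Qed.

Lemma psumS m l b : psum m l.+1 b = psum m l b + `|b (m + l)%N|.
Proof. by rewrite /psum addnS big_nat_recr//= leq_addr. Qed.

Lemma psum_ge0 m l b : 0 <= psum m l b.
Proof. exact: sumr_ge0. Qed.

Lemma psum_le m l l' b : (l <= l')%N -> psum m l b <= psum m l' b.
Proof.
elim: l' => [|l' IH]; first by rewrite leqn0 => /eqP ->.
rewrite leq_eqVlt => /predU1P[->//|/IH h]; rewrite psumS.
by rewrite (le_trans h)// lerDl.
Qed.

Lemma eq_psum m l b b' : (forall j, (m <= j < m + l)%N -> b j = b' j) ->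
  psum m l b = psum m l b'.
Proof. by move=> h; apply: eq_big_nat => j jl; rewrite h. Qed.

Lemma psum_upd m l q b (x : R) : (m + l <= q)%N -> psum m l (upd b q x) = psum m l b.
Proof. by move=> lq; apply: eq_psum => j jl; rewrite /upd ifN//; lia. Qed.

Lemma psumS_upd m l b (x : R) :
  psum m l.+1 (upd b (m + l) x) = psum m l b + `|x|.
Proof. by rewrite psumS psum_upd// /upd eqxx. Qed.

(* The number of clients among m, ..., m + k - 1 whose service is completed
   after a time t, when client m is in service at time 0. *)
Definition departed m k t b := count (fun c => psum m c.+1 b <= t) (iota 0 k).

(** If all k services are over, the next client brings a fresh service time, so the vector is
    unchanged. Otherwise client m + c is in service and its coordinate becomes the remaining
    time. *)
Definition residual m k t b : nat -> R :=
  let c := departed m k t b in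
  if c == k then b else upd b (m + c) (psum m c.+1 b - t).

Lemma departed_le m k t b : (departed m k t b <= k)%N.
Proof. by rewrite (leq_trans (count_size _ _))// size_iota. Qed.

(** Partial sums are nondecreasing, so the completed services form an initial segment and two
    neighbouring sums locate its length. *)
Lemma departedP m k t b c : 0 <= t -> (c <= k)%N ->
  (departed m k t b == c) = (psum m c b <= t) && ((c == k) || (t < psum m c.+1 b)).
Proof.
move=> t0; rewrite /departed; elim: k => [|k IH] in c *.
  by rewrite leqn0 => /eqP ->; rewrite psum0 t0.
rewrite -addn1 iotaD count_cat/= add0n addn0 addn1.
have [le|lt] := leP (psum m k.+1 b) t.
  have /IH : (k <= k)%N by []. rewrite eqxx orTb andbT.
  rewrite (le_trans (psum_le m b (leqnSn k)) le) => /eqP ->; rewrite addn1 => ck.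
  have [->|ck'] := eqVneq c k.+1; first by rewrite le.
  rewrite /=; apply/esym/negbTE.
  rewrite negb_and orbC -leNgt (le_trans _ le)//; apply: psum_le; lia.
rewrite addn0 leq_eqVlt ltnS => /predU1P[->|ck].
  rewrite (leNgt (psum m k.+1 b)) lt/=; apply/negbTE.
  by have := departed_le m k t b; rewrite /departed; lia.
rewrite IH//; have [->|ck'] := eqVneq c k; last by rewrite ltn_eqF// ltnS.
by rewrite ltn_eqF//= lt.
Qed.

End partial_sums.

Section integrals_of_partial_sums.
Context (R : realType) (n : nat).
Variables (mu : nat -> R) (Q : probability (services R n) R) (E : nat -> probability R R).
Local Notation Om := (services R n).

Lemma measurable_psum m l : (1 <= m)%N -> (m + l <= n.+1)%N ->
  measurable_fun setT (fun b : Om => psum m l b : R).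
Proof.
move=> m1; elim: l => [_|l IH ml].
  by rewrite (_ : (fun b => _) = cst 0) //; apply/funext => b; rewrite psum0.
rewrite (_ : (fun b => _) = (fun b : Om => psum m l b + `|b (m + l)%N|)); last first.
  by apply/funext => b; rewrite psumS.
apply: measurable_funD; first by apply: IH; lia.
by apply: (measurableT_comp (@normr_measurable R setT)); apply: measurable_coord; lia.
Qed.

Hypothesis Q_cyl : forall A, (forall j, measurable (A j)) ->
  Q (cylinder n A) = (\prod_(j <- iota 1 n) E j (A j))%E.
Hypothesis mu_gt0 : forall i, (1 <= i <= n)%N -> 0 < mu i.
Hypothesis E_exp : forall j, (1 <= j <= n)%N -> forall A : set R, measurable A ->
  E j A = exponential_prob (mu j) A.

(** Conditioning on the last summand gives a convolution, evaluated by [exp_law_convolution]. A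
    constant [kappa] yields distribution functions, the identity yields expected positive parts. *)
Lemma integral_psum (kappa : R -> R) (y : nat -> R -> R) m l t :
  measurable_fun setT kappa -> (forall s, 0 <= s -> 0 <= kappa s) ->
  (forall s, y 0%N s = kappa s) ->
  (forall l, (m + l <= n)%N -> continuous (y l)) ->
  (forall l, (m + l <= n)%N -> y l.+1 0 = 0) ->
  (forall l (s : R), (m + l <= n)%N ->
     is_derive s 1 (y l.+1) (mu (m + l)%N * (y l s - y l.+1 s))) ->
  (1 <= m)%N -> (m + l <= n.+1)%N -> 0 <= t ->
  (\int[Q]_b (if (psum m l b <= t)%R then (kappa (t - psum m l b))%:E else 0) = (y l t)%:E)%E.
Proof.
move=> mk k0 yk cy y0 dy m1; elim: l t => [|l IH] t ml t0.
  under eq_integral do rewrite psum0 t0 subr0.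
  by rewrite integral_cst// -[X in (_ * X)%E]/(Q setT) probability_setT mule1 yk.
have mterm (l' : nat) (s : R) : (m + l' <= n.+1)%N -> measurable_fun setT (fun b : Om =>
    if (psum m l' b <= s)%R then (kappa (s - psum m l' b))%:E else 0%E).
  move=> ml'; apply: measurable_fun_if => //.
    by apply: measurable_fun_ler => //; exact: measurable_psum.
  apply: measurable_funTS; apply/measurable_EFinP.
  by apply: (measurableT_comp mk); apply: measurable_funB => //; exact: measurable_psum.
have term0 (l' : nat) (s : R) b :
    (0 <= if (psum m l' b <= s)%R then (kappa (s - psum m l' b))%:E else 0)%E.
  by case: ifP => // h; rewrite lee_fin k0// subr_ge0.
rewrite (integral_resample Q_cyl (q := (m + l)%N))//; [|lia|exact: mterm].
pose F (z : Om * R) : \bar R := if (psum m l z.1 <= t - `|z.2|)%R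
   then (kappa (t - `|z.2| - psum m l z.1))%:E else 0%E.
transitivity (\int[Q]_b \int[E (m + l)%N]_x F (b, x))%E.
  apply: eq_integral => b _; apply: eq_integral => x _.
  by rewrite /F/= psumS_upd lerBrDr opprD addrA (addrAC t).
have mps : measurable_fun setT (fun z : Om * R => psum m l z.1 : R).
  by apply: (measurableT_comp (measurable_psum m1 _)) => //; lia.
have mtx : measurable_fun setT (fun z : Om * R => t - `|z.2| : R).
  apply: measurable_funB => //.
  by apply: (measurableT_comp (@normr_measurable R setT)).
have mF : measurable_fun setT F.
  apply: measurable_fun_if => //; first exact: measurable_fun_ler.
  apply: measurable_funTS; apply/measurable_EFinP.
  by apply: (measurableT_comp mk); exact: measurable_funB.
have F0 z : (0 <= F z)%E by apply: term0.
have := fubini_tonelli (m1 := Q) (m2 := E (m + l)%N) F mF F0 => /= ->.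
transitivity (\int[E (m + l)%N]_x (if (`|x| <= t)%R then (y l (t - `|x|))%:E else 0))%E.
  apply: eq_integral => x _; rewrite /F/=; case: ifPn => xt.
    by apply: IH; [lia|rewrite subr_ge0].
  rewrite integral0_eq// => b _; rewrite ifN// -ltNge (lt_le_trans _ (psum_ge0 _ _ _))//.
  by rewrite subr_lt0 ltNge.
apply: (exp_law_convolution (M := mu (m + l)%N)) => //.
- by apply: mu_gt0; lia.
- by apply: E_exp; lia.
- by apply: cy; lia.
(* By the induction hypothesis [y l] is the integral of a nonnegative function. *)
- by move=> s s0; rewrite -lee_fin -IH//; [exact: integral_ge0|lia].
- by apply: y0; lia.
- by move=> s; apply: dy; lia.
Qed.

Hypothesis mu_distinct : forall i j, (1 <= i <= n)%N -> (1 <= j <= n)%N ->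
  mu i = mu j -> i = j.

Lemma distinct_rates_le m l : (1 <= m)%N -> (m + l <= n)%N -> distinct_rates mu m l.
Proof.
move=> m1 ml j jl; split; first by apply: mu_gt0; lia.
by move=> j' j'l; apply: mu_distinct; lia.
Qed.

Lemma integral_psum_le m l t : (1 <= m)%N -> (m + l <= n.+1)%N -> 0 <= t ->
  (\int[Q]_b (if (psum m l b <= t)%R then 1 else 0) = (sumcdf mu m l t)%:E)%E.
Proof.
move=> m1 ml t0.
apply: (integral_psum (kappa := cst 1) (y := sumcdf mu m)) => //.
- move=> l' ml'; apply: continuous_sumcdf; case: l' ml' => // l' ml'.
  by apply: distinct_rates_le => //; lia.
- by move=> l' ml'; apply: sumcdf0; exact: distinct_rates_le.
- by move=> l' s ml'; apply: is_derive_sumcdf; exact: distinct_rates_le.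
Qed.

Lemma integral_slack m l t : (1 <= m)%N -> (m + l <= n.+1)%N -> 0 <= t ->
  (\int[Q]_b (Num.max 0 (t - psum m l b))%:E = (slack mu m l t)%:E)%E.
Proof.
move=> m1 ml t0.
transitivity (\int[Q]_b (if (psum m l b <= t)%R then (id (t - psum m l b))%:E else 0))%E.
  by apply: eq_integral => b _; rewrite maxEle subr_ge0; case: ifP.
apply: (integral_psum (kappa := id) (y := slack mu m)) => //.
- move=> l' ml'; apply: continuous_slack; case: l' ml' => // l' ml'.
  by apply: distinct_rates_le => //; lia.
- by move=> l' ml'; exact: slack0.
- by move=> l' s ml'; apply: is_derive_slackS; exact: distinct_rates_le.
Qed.

Lemma integral_min_psum m l t : (1 <= m)%N -> (m + l <= n.+1)%N -> 0 <= t ->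
  (\int[Q]_b (Num.min (psum m l b) t)%:E = (t - slack mu m l t)%:E)%E.
Proof.
move=> m1 ml t0.
have mp := measurable_psum m1 ml.
have h : (\int[Q]_b (Num.min (psum m l b) t)%:E + (slack mu m l t)%:E = t%:E)%E.
  rewrite -integral_slack// -ge0_integralD//.
  - transitivity (\int[Q]_b (cst t%:E b))%E.
      apply: eq_integral => b _ /=; rewrite -EFinD; congr EFin.
      by case: (leP (psum m l b) t) => h; case: (leP 0 (t - psum m l b)); lra.
    by rewrite integral_cst// -[X in (_ * X)%E]/(Q setT) probability_setT mule1.
  - by move=> b _; rewrite lee_fin le_min psum_ge0.
  - by apply/measurable_EFinP; exact: measurable_minr.
  - by move=> b _; rewrite lee_fin le_max lexx.
  - by apply/measurable_EFinP; apply: measurable_maxr => //; exact: measurable_funB.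
by rewrite EFinB -h addeK.
Qed.

Lemma integral_psum_id m l : (1 <= m)%N -> (m + l <= n.+1)%N ->
  (\int[Q]_b (psum m l b)%:E = (\sum_(m <= j < m + l) (mu j)^-1)%:E)%E.
Proof.
move=> m1; elim: l => [_|l IH ml].
  under eq_integral do rewrite psum0.
  by rewrite integral0 addn0 big_geq.
rewrite addnS big_nat_recr/= ?leq_addr// EFinD -IH; last lia.
rewrite -(@exp_law_mean _ (mu (m + l)%N) (E (m + l)%N)); [|by apply: mu_gt0;
  lia|by apply: E_exp; lia].
rewrite -(integral_coord Q_cyl (q := (m + l)%N))//; last 2 first.
- by lia.
- by apply/measurable_EFinP; exact: normr_measurable.
rewrite -ge0_integralD//.
- by apply: eq_integral => b _; rewrite psumS.
- by move=> b _; rewrite lee_fin psum_ge0.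
- by apply/measurable_EFinP; apply: measurable_psum => //; lia.
- apply/measurable_EFinP; apply: (measurableT_comp (@normr_measurable R setT)).
  by apply: measurable_coord; lia.
Qed.

End integrals_of_partial_sums.

(** * Transitions between arrivals *)

Definition step_prob (R : realType) (mu : nat -> R) (m k c : nat) (t : R) : R :=
  if c == k then sumcdf mu m k t else sumcdf mu m c t - sumcdf mu m c.+1 t.

Lemma sum_step_prob (R : realType) (mu : nat -> R) m k (t : R) : \sum_(0 <= c < k.+1)
  step_prob mu m k c t = 1.
Proof.
rewrite big_nat_recr//= {2}/step_prob eqxx.
rewrite (eq_big_nat _ _ (F2 := fun c => - (sumcdf mu m c.+1 t - sumcdf mu m c t))); last first.
  by move=> c ck; rewrite /step_prob ifN ?opprB//; lia.
by rewrite sumrN telescope_sumr// opprB subrK.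
Qed.

Section one_step.
Context (R : realType) (n : nat).
Variables (mu : nat -> R) (Q : probability (services R n) R) (E : nat -> probability R R).
Local Notation Om := (services R n).

Lemma measurable_if_event (b1 : Om -> bool) (h : Om -> \bar R) :
  measurable_fun setT b1 -> measurable_fun setT h ->
  measurable_fun setT (fun b => if b1 b then h b else 0%E).
Proof. by move=> m1 mh; apply: measurable_fun_if => //; exact: measurable_funTS. Qed.

Lemma measurable_interrupted m c t : (1 <= m)%N -> (m + c <= n)%N ->
  measurable_fun setT (fun b : Om => (psum m c b <= t) && (t < psum m c.+1 b)).
Proof.
move=> m1 mc; apply: measurable_and.
- by apply: measurable_fun_ler => //; apply: measurable_psum => //; lia.
- by apply: measurable_fun_ltr => //; apply: measurable_psum => //; lia.
Qed.

Lemma measurable_upd_psum m c t : (1 <= m)%N -> (m + c <= n)%N ->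
  measurable_fun setT (fun b : Om => upd b (m + c) (psum m c.+1 b - t) : Om).
Proof.
move=> m1 mc.
have mp : measurable_fun setT (fun b : Om => (b, psum m c.+1 b - t : R)).
  apply: measurable_fun_pair => //.
  by apply: measurable_funB => //; apply: measurable_psum => //; lia.
exact: (measurableT_comp (@measurable_upd R n (m + c)%N) mp).
Qed.

Hypothesis Q_cyl : forall A, (forall j, measurable (A j)) ->
  Q (cylinder n A) = (\prod_(j <- iota 1 n) E j (A j))%E.
Hypothesis mu_gt0 : forall i, (1 <= i <= n)%N -> 0 < mu i.
Hypothesis E_exp : forall j, (1 <= j <= n)%N -> forall A : set R, measurable A ->
  E j A = exponential_prob (mu j) A.

Section interrupted_service.
Variables (m c : nat) (t : R).
Hypotheses (m1 : (1 <= m)%N) (mc : (m + c <= n)%N) (t0 : 0 <= t).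

Let u (b : Om) : \bar R :=
  if psum m c b <= t then (expR (- mu (m + c)%N * (t - psum m c b)))%:E else 0%E.

(** Integrating coordinate m + c first, memorylessness replaces the excess by a fresh exponential
    time at the price of the factor [u]. This factor involves only coordinates below m + c and [K]
    only the others, so the integral splits. *)
Lemma integral_interrupted_indep (K : Om -> \bar R) :
  measurable_fun setT K -> (forall b, 0 <= K b)%E ->
  (forall b b', (forall j, (m + c <= j)%N -> b j = b' j) -> K b = K b') ->
  (\int[Q]_b (if (psum m c b <= t)%R && (t < psum m c.+1 b)%R
     then K (upd b (m + c) (psum m c.+1 b - t)) else 0) =
   \int[Q]_b u b * \int[Q]_b K b)%E.
Proof.
move=> mK K0 Kq.
have mqn : (1 <= m + c <= n)%N by lia.
have E_q := E_exp mqn; have mu_q := mu_gt0 mqn.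
have mpc : measurable_fun setT (fun b : Om => psum m c b : R).
  by apply: measurable_psum => //; lia.
have mKE b : measurable_fun setT (fun x : R => K (upd b (m + c) x)).
  by apply: (measurableT_comp mK);
    exact: (measurableT_comp (@measurable_upd R n (m + c)%N) (pair1_measurable (b : Om))).
pose w (b : Om) := (\int[E (m + c)%N]_x K (upd b (m + c) x))%E.
have w0 b : (0 <= w b)%E by exact: integral_ge0.
have mw : measurable_fun setT w.
  apply: (@measurable_fun_fubini_tonelli_F _ _ _ _ _ (E (m + c)%N) (fun z : Om * R =>
    K (upd z.1 (m + c) z.2))) => //.
  exact: (measurableT_comp mK (@measurable_upd R n (m + c)%N)).
have mu_ : measurable_fun setT u.
  apply: measurable_if_event; first exact: measurable_fun_ler.
  apply/measurable_EFinP; apply: (measurableT_comp (@measurable_expR R)).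
  by apply: measurable_funM => //; exact: measurable_funB.
have u0 b : (0 <= u b)%E by rewrite /u; case: ifP => // _; rewrite lee_fin expR_ge0.
rewrite (integral_resample Q_cyl (q := (m + c)%N))//; last 2 first.
- apply: measurable_if_event; first exact: measurable_interrupted.
  by apply: (measurableT_comp mK); exact: measurable_upd_psum.
- by move=> b; case: ifP.
transitivity (\int[Q]_b (u b * w b))%E.
  apply: eq_integral => b _; rewrite /u; case: ifPn => bt; last first.
    rewrite mul0e integral0_eq// => x _.
    by rewrite psum_upd// (negbTE bt).
  rewrite -(exp_law_memoryless E_q); [|by rewrite subr_ge0|exact: mKE|by []].
  pose F (x : R) : \bar R := if t - psum m c b < x then K (upd b (m + c) (x - (t - psum m c
    b))) else 0%E.
  have mF : measurable_fun setT F.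
    apply: measurable_fun_if => //; first exact: measurable_fun_ltr.
    apply: measurable_funTS; apply: (measurableT_comp (mKE b)).
    exact: measurable_funB.
  have updE (x : R) : (if (psum m c (upd b (m + c) x) <= t)%R &&
    (t < psum m c.+1 (upd b (m + c) x))%R
      then K (upd (upd b (m + c) x) (m + c) (psum m c.+1 (upd b (m + c) x) - t)) else 0%E)
        = F `|x|.
    rewrite psum_upd// bt psumS_upd /F ltrBlDl andTb; case: ifP => // _.
    congr (K _); apply/funext => j; rewrite /upd; case: eqP => // _; ring.
  under eq_integral do rewrite updE.
  apply: (exp_law_eq_integral E_q) => //.
  - by apply: (measurableT_comp mF); exact: normr_measurable.
  - by move=> x; rewrite /F; case: ifP.
  - by move=> x; rewrite /F; case: ifP.
  - by move=> x x0; rewrite gtr0_norm.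
rewrite (integral_indep Q_cyl (q := (m + c)%N))//.
- by congr (_ * _)%E; rewrite -integral_resample.
- move=> b b' bb'; rewrite /u (@eq_psum _ m c b b')// => j jl; apply: bb'; lia.
- move=> b b' bb'; apply: eq_integral => x _; apply: Kq => j jl.
  by rewrite /upd; case: eqP => // _; exact: bb'.
Qed.

Hypothesis mu_distinct : forall i j, (1 <= i <= n)%N -> (1 <= j <= n)%N ->
  mu i = mu j -> i = j.

Lemma integral_interrupted_event :
  (\int[Q]_b (if (psum m c b <= t)%R && (t < psum m c.+1 b)%R then 1 else 0) =
   (sumcdf mu m c t - sumcdf mu m c.+1 t)%:E)%E.
Proof.
have h : (\int[Q]_b (if (psum m c b <= t)%R && (t < psum m c.+1 b)%R then 1 else 0) +
   (sumcdf mu m c.+1 t)%:E = (sumcdf mu m c t)%:E)%E.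
  have ev (b : Om -> bool) x : (0 <= (if b x then 1 else 0 : \bar R))%E by case: ifP.
  have [mc0 mc1] : (m + c <= n.+1 /\ m + c.+1 <= n.+1)%N by lia.
  rewrite -!(integral_psum_le Q_cyl)// -ge0_integralD//.
  - apply: eq_integral => b _; have := psum_le m b (leqnSn c).
    case: (leP (psum m c.+1 b) t) => h1 h2.
      by rewrite (le_trans h2 h1) andbF add0e.
    by rewrite andbT adde0.
  - by move=> b _; case: ifP.
  - by apply: measurable_if_event => //; exact: measurable_interrupted.
  - by move=> b _; case: ifP.
  - by apply: measurable_if_event => //; apply: measurable_fun_ler => //;
    exact: measurable_psum.
by rewrite EFinB -h addeK.
Qed.

(** The factor found in [integral_interrupted_indep] is the same for every [K]; the case K = 1
    identifies it as the probability of the event. *)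
Lemma integral_interrupted (K : Om -> \bar R) :
  measurable_fun setT K -> (forall b, 0 <= K b)%E ->
  (forall b b', (forall j, (m + c <= j)%N -> b j = b' j) -> K b = K b') ->
  (\int[Q]_b (if (psum m c b <= t)%R && (t < psum m c.+1 b)%R
     then K (upd b (m + c) (psum m c.+1 b - t)) else 0) =
   (sumcdf mu m c t - sumcdf mu m c.+1 t)%:E * \int[Q]_b K b)%E.
Proof.
move=> mK K0 Kq; rewrite integral_interrupted_indep//; congr (_ * _)%E.
rewrite -integral_interrupted_event.
rewrite (integral_interrupted_indep (K := cst 1%E))//.
rewrite (_ : \int[Q]_b cst 1 b = 1)%E ?mule1//.
by rewrite integral_cst// mul1e; exact: probability_setT.
Qed.

End interrupted_service.

Hypothesis mu_distinct : forall i j, (1 <= i <= n)%N -> (1 <= j <= n)%N ->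
  mu i = mu j -> i = j.

Variables (m k : nat) (t : R).
Hypotheses (m1 : (1 <= m)%N) (mk : (m + k <= n.+1)%N) (t0 : 0 <= t).
Variable H : nat -> Om -> \bar R.
Hypothesis mH : forall c, (c <= k)%N -> measurable_fun setT (H c).
Hypothesis H0 : forall c b, (c <= k)%N -> (0 <= H c b)%E.
Hypothesis Hq : forall c b b', (c <= k)%N ->
  (forall j, (m + c <= j)%N -> b j = b' j) -> H c b = H c b'.

Let term c (b : Om) : \bar R :=
  if departed m k t b == c then H c (residual m k t b) else 0%E.

Let termE c (b : Om) : (c < k)%N -> term c b =
  if (psum m c b <= t)%R && (t < psum m c.+1 b)%R
     then H c (upd b (m + c) (psum m c.+1 b - t)) else 0%E.
Proof.
move=> ck; rewrite /term departedP//; last exact: ltnW.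
rewrite [c == k]ltn_eqF//= /residual; case: ifP => // h.
have /eqP -> : departed m k t b == c by rewrite departedP ?(ltnW ck)// [c == k]ltn_eqF.
by rewrite ltn_eqF.
Qed.

Let termkE (b : Om) : term k b = if (psum m k b <= t)%R then H k b else 0%E.
Proof.
rewrite /term departedP// eqxx andbT; case: ifP => // h.
have /eqP e : departed m k t b == k by rewrite departedP// eqxx h.
by rewrite /residual e eqxx.
Qed.

Let mterm c : (c <= k)%N -> measurable_fun setT (term c).
Proof.
rewrite leq_eqVlt => /predU1P[->|ck].
  rewrite (_ : term k = fun b => if (psum m k b <= t)%R then H k b else 0%E);
    last by apply/funext => b; exact: termkE.
  apply: measurable_if_event; last exact: mH.
  by apply: measurable_fun_ler => //; exact: measurable_psum.
rewrite (_ : term c = fun b => if (psum m c b <= t)%R && (t < psum m c.+1 b)%R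
     then H c (upd b (m + c) (psum m c.+1 b - t)) else 0%E); last by apply/funext => b;
       exact: termE.
apply: measurable_if_event; first by apply: measurable_interrupted => //; lia.
apply: (measurableT_comp (mH (ltnW ck))).
by apply: measurable_upd_psum => //; lia.
Qed.

Let sum_term (b : Om) : H (departed m k t b) (residual m k t b) = (\sum_(c < k.+1) term c b)%E.
Proof.
have dk : (departed m k t b < k.+1)%N by rewrite ltnS departed_le.
rewrite (bigD1 (Ordinal dk))//= {1}/term eqxx big1 ?adde0// => c cd.
by rewrite /term ifN// eq_sym.
Qed.

Lemma measurable_step : measurable_fun setT (fun b : Om =>
  H (departed m k t b) (residual m k t b)).
Proof.
rewrite (_ : (fun b => _) = (fun b => \sum_(c < k.+1) term c b)%E); last first.
  by apply/funext => b; exact: sum_term.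
by apply: emeasurable_sum => c; apply: mterm; rewrite -ltnS.
Qed.

(** Split over the number c of departures. For c < k the excess service time is renewed; for c = k
    the event concerns coordinates below m + k and [H k] the others, so independence suffices. *)
Lemma integral_step :
  (\int[Q]_b H (departed m k t b) (residual m k t b) =
   \sum_(0 <= c < k.+1) (step_prob mu m k c t)%:E * \int[Q]_b H c b)%E.
Proof.
under eq_integral do rewrite sum_term.
rewrite ge0_integral_sum//; last 2 first.
- by move=> c; apply: mterm; rewrite -ltnS.
- by move=> c b _; rewrite /term; case: ifP => // _; apply: H0; rewrite -ltnS.
rewrite big_mkord; apply: eq_bigr => -[c /=]; rewrite ltnS => ck _.
move: (ck); rewrite leq_eqVlt => /predU1P[e|ck'].
  rewrite e in ck *; rewrite /step_prob eqxx -(integral_psum_le Q_cyl)//.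
  under eq_integral do rewrite termkE.
  rewrite -(integral_indep Q_cyl (q := (m + k)%N))//; last first.
  - by move=> b b' bb'; exact: Hq.
  - by move=> b b' bb'; rewrite (@eq_psum _ m k b b')// => j jl; apply: bb'; lia.
  - by move=> b; exact: H0.
  - by move=> b; case: ifP.
  - exact: mH.
  - by apply: measurable_if_event => //; apply: measurable_fun_ler => //;
    exact: measurable_psum.
  by apply: eq_integral => b _; case: ifP => _; rewrite ?mul1e ?mul0e.
rewrite /step_prob ltn_eqF//.
under eq_integral do rewrite termE//.
apply: integral_interrupted => //; first lia.
- exact: mH.
- by move=> b; exact: H0.
- by move=> b b' bb'; exact: Hq.
Qed.

End one_step.

(** * Sums along the chain of states and their means *)

Section total_cost.
Context (R : realType) (n : nat) (tau : nat -> nat -> R).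
Local Notation Om := (services R n).
Implicit Types (s i k c : nat) (b : nat -> R).

(* A state of the queue just after the arrival of client i consists of the
   number k of clients present and of a vector b of service times, in which the
   coordinate (i - k).+1 of the client in service is its residual time. The
   coordinates below (i - k).+1 are irrelevant. *)
Definition next_nb i k b : nat := k.+1 - departed (i - k).+1 k (tau i k) b.

Definition next_services i k b : nat -> R := residual (i - k).+1 k (tau i k) b.

(** Two uses are intended: genuine stage costs give the cost to go, while zero stage costs evaluate
    [fin] at the state reached, which gives the law of that state. *)
Fixpoint total (st : nat -> nat -> (nat -> R) -> \bar R) (fin : nat -> (nat -> R) -> \bar R)
    s i k b : \bar R :=
  if s is s'.+1 then
    (st i k b + total st fin s' i.+1 (next_nb i k b) (next_services i k b))%E
  else fin k b.

Fixpoint run s i k b : nat * (nat -> R) :=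
  if s is s'.+1 then run s' i.+1 (next_nb i k b) (next_services i k b) else (k, b).

Lemma total_run fin s i k b :
  total (fun _ _ _ => 0%E) fin s i k b = fin (run s i k b).1 (run s i k b).2.
Proof. by elim: s i k b => //= s IH i k b; rewrite add0e IH. Qed.

Variables (mu : nat -> R) (Q : probability Om R) (E : nat -> probability R R).

(** No vector is carried along: after each step it again has the law [Q], so only the number of
    clients is propagated. *)
Fixpoint mean_total (st : nat -> nat -> (nat -> R) -> \bar R) (fin : nat -> (nat -> R) ->
  \bar R)
    s i k : \bar R :=
  if s is s'.+1 then
    (\int[Q]_(b in [set: Om]) st i k b + \sum_(0 <= c < k.+1)
       (step_prob mu (i - k).+1 k c (tau i k))%:E *
       mean_total st fin s' i.+1 (k.+1 - c))%E
  else (\int[Q]_(b in [set: Om]) fin k b)%E.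

(** The coordinates above i - k belong to the client in service and to all later clients; the past
    must not enter. *)
Definition future_function i k (h : (nat -> R) -> \bar R) :=
  [/\ measurable_fun [set: Om] h, forall b, (0 <= h b)%E &
      forall b b', (forall j, (i - k < j)%N -> b j = b' j) -> h b = h b'].

Hypothesis tau_ge0 : forall j k, 0 <= tau j k.
Hypothesis Q_cyl : forall A, (forall j, measurable (A j)) ->
  Q (cylinder n A) = (\prod_(j <- iota 1 n) E j (A j))%E.
Hypothesis mu_gt0 : forall i, (1 <= i <= n)%N -> 0 < mu i.
Hypothesis mu_distinct : forall i j, (1 <= i <= n)%N -> (1 <= j <= n)%N ->
  mu i = mu j -> i = j.
Hypothesis E_exp : forall j, (1 <= j <= n)%N -> forall A : set R, measurable A ->
  E j A = exponential_prob (mu j) A.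

Variables (st : nat -> nat -> (nat -> R) -> \bar R) (fin : nat -> (nat -> R) -> \bar R).
Hypothesis st_future : forall i k, (1 <= k <= i)%N -> (i <= n)%N -> future_function i k (st
  i k).

Lemma eq_departed m k t b b' : (forall j, (m <= j)%N -> b j = b' j) ->
  departed m k t b = departed m k t b'.
Proof.
move=> bb'; apply: eq_in_count => c _.
by rewrite (@eq_psum _ m c.+1 b b')// => j jl; apply: bb'; lia.
Qed.

Lemma eq_residual m k t b b' : (forall j, (m <= j)%N -> b j = b' j) ->
  forall j, (m <= j)%N -> residual m k t b j = residual m k t b' j.
Proof.
move=> bb' j mj; rewrite /residual (eq_departed _ _ bb').
case: ifP => _; first exact: bb'.
rewrite /upd; case: ifP => _; last exact: bb'.
by rewrite (@eq_psum _ m _ b b')// => j' jl; apply: bb'; lia.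
Qed.

(** Regularity and the integral go together because the induction step integrates the remaining sum
    over the next state. *)
Lemma total_future s i k : (1 <= k <= i)%N -> (i + s <= n)%N ->
  (forall k', (1 <= k' <= i + s)%N -> future_function (i + s) k' (fin k')) ->
  future_function i k (total st fin s i k) /\
  (\int[Q]_(b in [set: Om]) total st fin s i k b = mean_total st fin s i k)%E.
Proof.
elim: s i k => [|s IH] i k ki isn ffin.
  by split => //; have := ffin k; rewrite addn0; apply.
have IHc c : (c <= k)%N ->
    future_function i.+1 (k.+1 - c) (total st fin s i.+1 (k.+1 - c)) /\
    (\int[Q]_(b in [set: Om]) total st fin s i.+1 (k.+1 - c) b =
     mean_total st fin s i.+1 (k.+1 - c))%E.
  move=> ck; apply: IH; [lia|lia|].
  by move=> k' k'n; have := ffin k'; rewrite addSnnS; apply; lia.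
pose H c := total st fin s i.+1 (k.+1 - c).
have mH c : (c <= k)%N -> measurable_fun [set: Om] (H c) by move=> /IHc[[]].
have H0 c b : (c <= k)%N -> (0 <= H c b)%E by move=> /IHc[[_ h _] _]; exact: h.
have Hq c b b' : (c <= k)%N -> (forall j, ((i - k).+1 + c <= j)%N -> b j = b' j) -> H c b =
  H c b'.
  move=> ck bb'; have [[_ _ h] _] := IHc c ck; apply: h => j jl; apply: bb'; lia.
have [mst st0 stq] := @st_future i k ki (leq_trans (leq_addr _ _) isn).
have m1 : (1 <= (i - k).+1)%N by [].
have mk : ((i - k).+1 + k <= n.+1)%N by lia.
have mstep : measurable_fun [set: Om] (fun b =>
  H (departed (i - k).+1 k (tau i k) b) (residual (i - k).+1 k (tau i k) b)).
  exact: (measurable_step m1 mk (tau_ge0 i k) mH).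
have step0 b : (0 <= H (departed (i - k).+1 k (tau i k) b) (residual (i - k).+1 k (tau i k)
  b))%E.
  by apply: H0; exact: departed_le.
split; first split.
- by apply: emeasurable_funD.
- by move=> b; apply: adde_ge0; [exact: st0|exact: step0].
- move=> b b' bb' /=; congr (_ + _)%E; first exact: stq.
  rewrite /next_nb /next_services (eq_departed _ _ bb').
  have dk := departed_le (i - k).+1 k (tau i k) b'.
  apply: (Hq _ _ _ dk) => j jl; apply: eq_residual => //; lia.
rewrite /= ge0_integralD//; last by move=> b _; exact: step0.
congr (_ + _)%E.
rewrite (integral_step Q_cyl mu_gt0 E_exp mu_distinct m1 mk (tau_ge0 i k) mH H0 Hq).
apply: eq_big_nat => c /andP[_ ck]; congr (_ * _)%E.
by have [_ ->] := IHc c ck.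
Qed.

End total_cost.

Section transition_probabilities.
Context (R : realType) (n : nat) (mu : nat -> R).
Implicit Types (i k c l : nat).
Hypothesis mu_gt0 : forall i, (1 <= i <= n)%N -> 0 < mu i.
Hypothesis mu_distinct : forall i j, (1 <= i <= n)%N -> (1 <= j <= n)%N ->
  mu i = mu j -> i = j.

Lemma p_step_prob i k c t : (1 <= k <= i)%N -> (i <= n)%N -> (c <= k)%N ->
  p mu k (k.+1 - c) i t = step_prob mu (i - k).+1 k c t.
Proof.
move=> ki in_ ck.
have good : distinct_rates mu (i - k).+1 k.-1.
  by apply: (distinct_rates_le mu_gt0 mu_distinct) => //; lia.
rewrite /step_prob; have [->|ck'] := eqVneq c k.
  by rewrite subSnn p1_sumcdf.
rewrite /p ifN; last lia.
rewrite p_ge2_sumcdf//; [|lia|lia].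
by congr (sumcdf _ _ _ _ - sumcdf _ _ _ _); lia.
Qed.

(** The index l counts clients after the arrival, c counts departures before it; l = k + 1 - c
    reverses the sum. *)
Lemma sum_p i k t (F : nat -> R) : (1 <= k <= i)%N -> (i <= n)%N ->
  \sum_(1 <= l < k.+2) p mu k l i t * F l =
  \sum_(0 <= c < k.+1) step_prob mu (i - k).+1 k c t * F (k.+1 - c)%N.
Proof.
move=> ki in_; rewrite big_add1/= big_nat_rev/= add0n.
apply: eq_big_nat => c ck; rewrite (_ : (k.+1 - c.+1).+1 = k.+1 - c)%N; last lia.
by rewrite p_step_prob//; lia.
Qed.

End transition_probabilities.

(** * Expected cost of a policy, period by period *)

Section expected_cost.
Context (R : realType) (n : nat) (mu : nat -> R) (omega : R) (tau : nat -> nat -> R).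
Local Notation Om := (services R n).
Implicit Types (s i k c l : nat) (b : nat -> R).

(** If S_l is the time until l services have ended, the l-th waiting client waits until S_l or the
    next arrival, whichever is first, and the server idles from S_k on. *)
Definition stage_cost i k b : R :=
  omega * Num.max 0 (tau i k - psum (i - k).+1 k b) +
  (1 - omega) * \sum_(1 <= l < k) Num.min (psum (i - k).+1 l b) (tau i k).

Definition final_cost k b : R := (1 - omega) * \sum_(1 <= l < k) psum (n - k).+1 l b.

Definition final_value k : R :=
  (1 - omega) * \sum_(0 <= l < k) (k - l - 1)%:R * (mu (n - k + l + 1)%N)^-1.

Definition stage_value i k (t : R) : R := omega * f mu k i t + (1 - omega) * g mu k i t.

Fixpoint policy_value s i k : R :=
  if s is s'.+1 then
    stage_value i k (tau i k) +
      \sum_(1 <= l < k.+2) p mu k l i (tau i k) * policy_value s' i.+1 l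
  else final_value k.

Hypothesis tau_ge0 : forall j k, 0 <= tau j k.
Hypothesis omega01 : 0 <= omega <= 1.
Variables (Q : probability Om R) (E : nat -> probability R R).
Hypothesis Q_cyl : forall A, (forall j, measurable (A j)) ->
  Q (cylinder n A) = (\prod_(j <- iota 1 n) E j (A j))%E.
Hypothesis mu_gt0 : forall i, (1 <= i <= n)%N -> 0 < mu i.
Hypothesis mu_distinct : forall i j, (1 <= i <= n)%N -> (1 <= j <= n)%N ->
  mu i = mu j -> i = j.
Hypothesis E_exp : forall j, (1 <= j <= n)%N -> forall A : set R, measurable A ->
  E j A = exponential_prob (mu j) A.

Lemma stage_cost_ge0 i k b : 0 <= stage_cost i k b.
Proof.
case/andP: omega01 => w0 w1; apply: addr_ge0; apply: mulr_ge0 => //.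
- by rewrite le_max lexx.
- by rewrite subr_ge0.
- by apply: sumr_ge0 => l _; rewrite le_min psum_ge0 tau_ge0.
Qed.

Lemma final_cost_ge0 k b : 0 <= final_cost k b.
Proof.
case/andP: omega01 => w0 w1; apply: mulr_ge0; first by rewrite subr_ge0.
by apply: sumr_ge0 => l _; exact: psum_ge0.
Qed.

Lemma measurable_sum_nat (F : nat -> Om -> R) a c :
  (forall l, (a <= l < c)%N -> measurable_fun setT (F l)) ->
  measurable_fun setT (fun b : Om => \sum_(a <= l < c) F l b).
Proof.
move=> mF; rewrite (_ : (fun b => _) = (fun b =>
  \sum_(l <- index_iota a c) if (a <= l < c)%N then F l b else 0)).
  by apply: measurable_sum => l; have [lk|lk] := boolP (a <= l < c)%N;
    [exact: mF|exact: measurable_cst].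
by apply/funext => b; apply: eq_big_nat => l ->.
Qed.

Lemma ge0_integral_sum_nat (F : nat -> Om -> R) a c :
  (forall l, (a <= l < c)%N -> measurable_fun setT (F l)) ->
  (forall l b, 0 <= F l b) ->
  (\int[Q]_b (\sum_(a <= l < c) F l b)%:E = \sum_(a <= l < c) \int[Q]_b (F l b)%:E)%E.
Proof.
move=> mF F0.
transitivity (\int[Q]_b (\sum_(l <- index_iota a c) (if (a <= l < c)%N then F l b else
  0)%:E))%E.
  by apply: eq_integral => b _; rewrite sumEFin; congr EFin; apply: eq_big_nat => l ->.
rewrite ge0_integral_sum//.
- by apply: eq_big_nat => l ->.
- by move=> l; apply/measurable_EFinP; have [lk|lk] := boolP (a <= l < c)%N;
  [exact: mF|exact: measurable_cst].
- by move=> l b _; case: ifP => _; rewrite lee_fin.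
Qed.

Lemma ge0_integralZl_fin (h : Om -> R) (x : R) : measurable_fun setT h ->
  (forall b, 0 <= h b) -> 0 <= x ->
  (\int[Q]_b (x%:E * (h b)%:E) = x%:E * \int[Q]_b (h b)%:E)%E.
Proof.
move=> mh h0 x0; apply: ge0_integralZl => //; first exact/measurable_EFinP.
by move=> b _; rewrite lee_fin.
Qed.

Lemma stage_cost_future i k : (1 <= k <= i)%N -> (i <= n)%N ->
  future_function n i k (fun b => (stage_cost i k b)%:E).
Proof.
move=> ki in_; split.
- apply/measurable_EFinP; apply: measurable_funD; apply: measurable_funM => //.
    apply: measurable_maxr => //; apply: measurable_funB => //.
    by apply: measurable_psum; lia.
  apply: measurable_sum_nat => l lk; apply: measurable_minr => //.
  by apply: measurable_psum; lia.
- by move=> b; rewrite lee_fin stage_cost_ge0.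
- move=> b b' bb'; congr (EFin (_ * Num.max _ (_ - _) + _ * _)).
    by apply: eq_psum => j jl; apply: bb'; lia.
  apply: eq_bigr => l _; congr (Num.min _ _).
  by apply: eq_psum => j jl; apply: bb'; lia.
Qed.

Lemma final_cost_future k : (1 <= k <= n)%N ->
  future_function n n k (fun b => (final_cost k b)%:E).
Proof.
move=> kn; split.
- apply/measurable_EFinP; apply: measurable_funM => //.
  by apply: measurable_sum_nat => l lk; apply: measurable_psum; lia.
- by move=> b; rewrite lee_fin final_cost_ge0.
- move=> b b' bb'; congr (EFin (_ * _)); apply: eq_bigr => l _.
  by apply: eq_psum => j jl; apply: bb'; lia.
Qed.

Lemma integral_stage_cost i k : (1 <= k <= i)%N -> (i <= n)%N ->
  (\int[Q]_(b in [set: Om]) (stage_cost i k b)%:E = (stage_value i k (tau i k))%:E)%E.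
Proof.
move=> ki in_; case/andP: omega01 => w0 w1.
have good : distinct_rates mu (i - k).+1 k.-1.
  by apply: (distinct_rates_le mu_gt0 mu_distinct) => //; lia.
rewrite /stage_value f_slack// g_slack// EFinD !EFinM.
have mp l : (l <= k)%N -> measurable_fun setT (fun b : Om => psum (i - k).+1 l b : R).
  by move=> lk; apply: measurable_psum; lia.
have mmax : measurable_fun setT (fun b : Om => Num.max 0 (tau i k - psum (i - k).+1 k b) : R).
  by apply: measurable_maxr => //; apply: measurable_funB => //; exact: mp.
have mmin l : (1 <= l < k)%N -> measurable_fun setT (fun b : Om =>
  Num.min (psum (i - k).+1 l b) (tau i k) : R).
  by move=> lk; apply: measurable_minr => //; apply: mp; lia.
have min0 l b : 0 <= Num.min (psum (i - k).+1 l b) (tau i k) by rewrite le_min psum_ge0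
  tau_ge0.
transitivity (\int[Q]_b (omega%:E * (Num.max 0 (tau i k - psum (i - k).+1 k b))%:E +
   (1 - omega)%:E * (\sum_(1 <= l < k) Num.min (psum (i - k).+1 l b) (tau i k))%:E))%E.
  by apply: eq_integral.
rewrite ge0_integralD//.
- rewrite ge0_integralZl_fin//; last by move=> b; rewrite le_max lexx.
  rewrite ge0_integralZl_fin ?subr_ge0//; last 2 first.
  + exact: measurable_sum_nat.
  + by move=> b; exact: sumr_ge0.
  rewrite (integral_slack Q_cyl mu_gt0 E_exp mu_distinct)//; last lia.
  rewrite ge0_integral_sum_nat// -sumEFin; congr (_ + _ * _)%E.
  apply: eq_big_nat => l lk.
  by apply: (integral_min_psum Q_cyl mu_gt0 E_exp mu_distinct) => //; lia.
- by move=> b _; rewrite -EFinM lee_fin mulr_ge0// le_max lexx.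
- by apply/measurable_EFinP; apply: measurable_funM.
- by move=> b _; rewrite -EFinM lee_fin mulr_ge0// ?subr_ge0// sumr_ge0.
- by apply/measurable_EFinP; apply: measurable_funM => //; exact: measurable_sum_nat.
Qed.

Lemma sum_sum_rates (x : nat -> R) m k :
  \sum_(1 <= l < k) \sum_(m <= j < m + l) x j = \sum_(0 <= l < k) (k - l - 1)%:R * x (m + l)%N.
Proof.
elim: k => [|[|k] IH]; first by rewrite !big_geq.
  by rewrite big_geq// big_nat1 mul0r.
rewrite big_nat_recr//= IH [RHS]big_nat_recr//= subSnn subnn mul0r addr0.
rewrite [RHS](eq_big_nat _ _ (F2 := fun l =>
  (k.+1 - l - 1)%:R * x (m + l)%N + x (m + l)%N)); last first.
  move=> l lk; rewrite (_ : (k.+2 - l - 1 = (k.+1 - l - 1).+1)%N); last lia.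
  by rewrite -natr1 mulrDl mul1r.
rewrite big_split/=; congr (_ + _).
by rewrite -{1}[m]add0n big_addn addKn; apply: eq_bigr => l _; rewrite addnC.
Qed.

Lemma integral_final_cost k : (1 <= k <= n)%N ->
  (\int[Q]_(b in [set: Om]) (final_cost k b)%:E = (final_value k)%:E)%E.
Proof.
move=> kn; case/andP: omega01 => w0 w1; rewrite /final_cost /final_value.
under eq_integral do rewrite EFinM.
rewrite ge0_integralZl_fin ?subr_ge0//; last 2 first.
- by apply: measurable_sum_nat => l lk; apply: measurable_psum; lia.
- by move=> b; apply: sumr_ge0 => l _; exact: psum_ge0.
rewrite EFinM; congr (_ * _)%E.
rewrite ge0_integral_sum_nat; last 2 first.
- by move=> l lk; apply: measurable_psum; lia.
- by move=> l b; exact: psum_ge0.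
rewrite (eq_big_nat _ _ (F2 := fun l =>
  (\sum_((n - k).+1 <= j < (n - k).+1 + l) (mu j)^-1)%:E)); last first.
  by move=> l lk; rewrite (integral_psum_id Q_cyl mu_gt0 E_exp)//; lia.
rewrite sumEFin sum_sum_rates; congr EFin; apply: eq_big_nat => l _.
by rewrite addn1 addSn.
Qed.

Lemma mean_total_cost s i k : (1 <= k <= i)%N -> (i + s = n)%N ->
  mean_total tau mu Q (fun i k b => (stage_cost i k b)%:E) (fun k b =>
    (final_cost k b)%:E) s i k =
  (policy_value s i k)%:E.
Proof.
elim: s i k => [|s IH] i k ki isn /=.
  by apply: integral_final_cost; lia.
rewrite integral_stage_cost ?(sum_p mu_gt0 mu_distinct); [|lia..].
rewrite [RHS]EFinD -sumEFin; congr (_ + _)%E; apply: eq_big_nat => c ck.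
by rewrite IH ?EFinM//; lia.
Qed.

End expected_cost.

(** * Sample paths *)

Section sample_path.
Context (R : realType) (n : nat) (tau : nat -> nat -> R) (b : nat -> R).
Implicit Types (i j k c l : nat) (s : R).

Local Notation arr := (arrival tau b).
Local Notation dep := (departure tau b).
Local Notation start := (service_start tau b).
Local Notation nb := (nb_in_system tau b).

Lemma arrivalS i : (1 <= i)%N -> arr i.+1 = arr i + tau i (nb i).
Proof.
rewrite /arrival /nb_in_system /arrival /=; case: (history tau b i) => a ds /=.
by case: i.
Qed.

Lemma arrival1 : arr 1 = 0.
Proof. by []. Qed.

Lemma departureS i : dep i.+1 = Num.max (arr i.+1) (dep i) + b i.+1.
Proof.
by rewrite /departure /arrival /=; case: (history tau b i) => a ds /=; rewrite last_rcons.
Qed.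

Lemma departures i : (history tau b i).2 = [seq dep j | j <- iota 1 i].
Proof.
elim: i => // i IH; rewrite -addn1 iotaD map_cat -IH /= add1n addn1 /departure /=.
by case: (history tau b i) => a ds /=; rewrite last_rcons cats1.
Qed.

Lemma nb_count i : nb i = count (fun j => arr i < dep j) (iota 1 i).
Proof. by rewrite /nb_in_system departures count_map. Qed.

Lemma service_startS i : start i.+1 = Num.max (arr i.+1) (dep i).
Proof. by []. Qed.

Hypothesis tau_ge0 : forall j k, 0 <= tau j k.

Lemma arrival_le i j : (1 <= i <= j)%N -> arr i <= arr j.
Proof.
move=> /andP[i1]; elim: j => [|j IH]; first by rewrite leqn0 => /eqP ->.
rewrite leq_eqVlt => /predU1P[->//|ij].
by rewrite (le_trans (IH ij))// arrivalS ?lerDl//; exact: leq_trans i1 ij.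
Qed.

Lemma arrival_ge0 i : (1 <= i)%N -> 0 <= arr i.
Proof. by move=> i1; rewrite -arrival1; apply: arrival_le; rewrite i1. Qed.

Hypothesis b_gt0 : forall j, (1 <= j <= n)%N -> 0 < b j.

Lemma departureS_gt i : (i < n)%N -> dep i < dep i.+1.
Proof.
move=> i_n; rewrite departureS (le_lt_trans _ (_ : dep i + 0 < _))//; last first.
  by rewrite ler_ltD ?le_max ?lexx ?orbT ?b_gt0.
by rewrite addr0.
Qed.

Lemma departure_le i j : (i <= j <= n)%N -> dep i <= dep j.
Proof.
move=> /andP[]; elim: j => [|j IH]; first by rewrite leqn0 => /eqP ->.
rewrite leq_eqVlt => /predU1P[->//|ij] jn.
by rewrite (le_trans (IH ij (ltnW jn)))// ltW// departureS_gt.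
Qed.

Lemma start_lt_departure i : (1 <= i <= n)%N -> start i < dep i.
Proof. by case: i => // i i_n; rewrite departureS service_startS ltrDl b_gt0. Qed.

Lemma arrival_le_start i : arr i <= start i.
Proof. by rewrite le_max lexx. Qed.

Lemma arrival_lt_departure i : (1 <= i <= n)%N -> arr i < dep i.
Proof. by move=> i_n; rewrite (le_lt_trans (arrival_le_start i)) ?start_lt_departure. Qed.

Lemma nb_gt0 i : (1 <= i <= n)%N -> (0 < nb i)%N.
Proof.
move=> i_n; rewrite nb_count -has_count; apply/hasP; exists i;
  last exact: arrival_lt_departure.
by rewrite mem_iota; lia.
Qed.

Lemma nb_le i : (nb i <= i)%N.
Proof. by rewrite nb_count (leq_trans (count_size _ _))// size_iota. Qed.

(* The clients present are the last ones, since clients depart in their order. *)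
Lemma nb_eq i k s : (i <= n)%N -> (k <= i)%N -> s < dep (i - k).+1 \/ k = 0 ->
  dep (i - k) <= s \/ k = i -> count (fun j => s < dep j) (iota 1 i) = k.
Proof.
move=> i_n ki h1 h2.
rewrite -[X in iota 1 X](subnK ki) iotaD count_cat add1n.
rewrite (_ : count _ (iota 1 (i - k)) = 0)%N; last first.
  apply/eqP; rewrite -leqn0 leqNgt -has_count; apply/hasPn => j; rewrite mem_iota => jk.
  rewrite -leNgt; case: h2 => [h2|kE]; last lia.
  by rewrite (le_trans _ h2)// departure_le//; lia.
rewrite add0n -[RHS](size_iota (i - k).+1 k); apply/eqP; rewrite -all_count.
apply/allP => j; rewrite mem_iota => jk.
case: h1 => [h1|k0]; last lia.
by rewrite (lt_le_trans h1)// departure_le//; lia.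
Qed.

(** Departure times increase, so the clients gone when client i arrives are 1, ..., m for the
    largest m with [dep m <= arr i]. *)
Lemma departure_nb i : (1 <= i <= n)%N ->
  dep (i - nb i) <= arr i < dep (i - nb i).+1.
Proof.
move=> i_n.
have [m [mi h1 h2]] : exists m, [/\ (m < i)%N, dep m <= arr i & arr i < dep m.+1].
  (* [dep 0] is the default 0 of [last], so m = 0 is always a candidate. *)
  have ex0 : dep 0 <= arr i by rewrite arrival_ge0//; lia.
  have exm : exists m, (m < i)%N && (dep m <= arr i) by exists 0%N; rewrite ex0; lia.
  have ubm m : (m < i)%N && (dep m <= arr i) -> (m <= i)%N by lia.
  have [m /andP[mi hm] hmax] := ex_maxnP exm ubm; exists m; split => //.
  rewrite ltNge; apply/negP => hm1.
  have [mi'|] := ltnP m.+1 i; first by have := hmax m.+1; rewrite mi' hm1 => /(_ isT); lia.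
  move=> im; have e : m.+1 = i by lia.
  by move: hm1; rewrite e leNgt arrival_lt_departure.
have -> : nb i = (i - m)%N.
  rewrite nb_count; apply: nb_eq; [lia|lia|left|left].
    by rewrite subKn//; lia.
  by rewrite subKn//; lia.
by rewrite subKn ?h1 ?h2//; lia.
Qed.

(** Client j is still present when client i arrives, and client j + 1 has arrived by then, so the
    server passes from one to the other without idling. *)
Lemma departure_present i j : (1 <= i <= n)%N -> (i - nb i < j < i)%N ->
  start j.+1 = dep j /\ dep j.+1 = dep j + b j.+1.
Proof.
move=> i_n jk; have /andP[_ h] := departure_nb i_n.
have h' : arr j.+1 <= dep j.
  rewrite (le_trans (arrival_le (j := i) _)) ?(le_trans (ltW h)) ?departure_le//; lia.
by rewrite service_startS departureS (max_idPr h').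
Qed.

(** The link between the recursion on vectors and the path of [b]: the client in service has its
    remaining time, later clients their full service times, and earlier coordinates are free. *)
Definition in_state i k (v : nat -> R) : Prop :=
  [/\ nb i = k, v (i - k).+1 = dep (i - k).+1 - arr i &
      forall j, ((i - k).+1 < j <= n)%N -> v j = b j].

Lemma in_state1 : (1 <= n)%N -> in_state 1 1 b.
Proof.
move=> n1; have nb1 : nb 1 = 1%N.
  have := nb_le 1; have := nb_gt0 (i := 1); lia.
split => //; rewrite subnn departureS arrival1 subr0.
by rewrite (max_idPl _) ?add0r.
Qed.

Section state.
Variables (i k : nat) (v : nat -> R).
Hypotheses (i_n : (1 <= i <= n)%N) (st : in_state i k v).

Lemma in_state_nb : (1 <= k <= i)%N.
Proof. by case: st => <- _ _; rewrite nb_gt0// nb_le. Qed.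

Lemma in_state_psum l : (1 <= l <= k)%N -> arr i + psum (i - k).+1 l v = dep (i - k + l).
Proof.
have ki := in_state_nb; case: st => nbk vm vb.
have /andP[h1 h2] := departure_nb i_n.
elim: l => // -[|l] IH lk.
  rewrite psumS psum0 add0r addn0 vm addn1 ger0_norm ?subr_ge0; last first.
    by rewrite -nbk ltW.
  by rewrite addrC subrK.
rewrite psumS addrA IH; last lia.
have [|_ e] := @departure_present i (i - k + l.+1)%N i_n; first by rewrite nbk; lia.
rewrite [in RHS]addnS e.
rewrite vb; last lia.
by rewrite addSn ger0_norm// ltW// b_gt0//; lia.
Qed.

Lemma in_state_psum_start l : (1 <= l < k)%N -> arr i + psum (i - k).+1 l v = start ((i -
  k).+1 + l)%N.
Proof.
have ki := in_state_nb.
move=> lk; rewrite in_state_psum; last lia.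
have [nbk _ _] := st.
have [|-> _] := @departure_present i (i - k + l)%N i_n; first by rewrite nbk; lia.
by [].
Qed.

Hypothesis i_lt_n : (i < n)%N.

(** The number c of departures is read off [v]; [low] and [high] turn it into departure times on
    either side of the next arrival, from which [nb_eq] gives the new count. *)
Lemma in_state_next : in_state i.+1 (next_nb tau i k v) (next_services tau i k v).
Proof.
have ki := in_state_nb; have [nbk vm vb] := st.
have aS : arr i.+1 = arr i + tau i k by rewrite arrivalS ?nbk//; lia.
set c := departed (i - k).+1 k (tau i k) v.
have ck : (c <= k)%N := departed_le _ _ _ _.
have := departedP (i - k).+1 v (tau_ge0 i k) ck; rewrite -/c eqxx => /esym/andP[h1 h2].
have m_eq : (i.+1 - (k.+1 - c) = i - k + c)%N by lia.
have low : dep (i - k + c) <= arr i.+1.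
  case: (posnP c) => [->|c0].
    have /andP[h _] := departure_nb i_n; rewrite addn0 -nbk (le_trans h)//.
    by apply: arrival_le; lia.
  by rewrite -in_state_psum ?aS ?lerD2l//; lia.
(* For c = k the bound is the departure of the newly arrived client i + 1. *)
have high : arr i.+1 < dep (i - k + c).+1.
  case/orP: h2 => [/eqP ->|h2].
    rewrite (_ : i - k + k = i)%N; last lia.
    by apply: arrival_lt_departure; lia.
  have [->|ck'] := eqVneq c k.
    rewrite (_ : i - k + k = i)%N; last lia.
    by apply: arrival_lt_departure; lia.
  by rewrite -addnS -in_state_psum ?aS ?ltrD2l//; lia.
rewrite /next_nb -/c /next_services /residual -/c; split.
- by rewrite nb_count; apply: nb_eq; rewrite ?m_eq; [lia|lia|left|left].
- rewrite m_eq; case: eqP => ck'.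
    rewrite ck' (_ : (i - k + k).+1 = i.+1)%N; last lia.
    rewrite vb; last lia.
    rewrite departureS (max_idPl _).
      by rewrite addrAC subrr add0r.
    by move: low; rewrite ck' subnK//; lia.
  rewrite /upd eqxx aS opprD addrA; congr (_ - _).
  by rewrite -addnS -in_state_psum ?(addrC (arr i)) ?addrK//; lia.
- move=> j; rewrite m_eq => jl; case: eqP => ck'; first by apply: vb; lia.
  rewrite /upd ifN; last lia.
  by apply: vb; lia.
Qed.

End state.

Lemma in_state_run q i k v : (1 <= i)%N -> (i + q <= n)%N -> in_state i k v ->
  in_state (i + q) (run tau q i k v).1 (run tau q i k v).2.
Proof.
elim: q i k v => [|q IH] i k v i1 isn st; first by rewrite addn0.
rewrite addnS -addSn /=; apply: IH; [lia|lia|].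
by apply: in_state_next => //; lia.
Qed.

End sample_path.

(** * Idle and waiting times on a sample path *)

Lemma lebesgue_measure_co (R : realType) (x y : R) :
  lebesgue_measure (`[x, y[%classic : set R) = (Num.max 0 (y - x))%:E.
Proof.
rewrite lebesgue_measure_itv/= lte_fin -EFinB.
case: (ltP x y) => h; congr EFin; rewrite maxEle subr_ge0; first by rewrite ltW.
by case: leP => // h'; lra.
Qed.

Lemma max0_subr_le (R : realType) (x y : R) : x <= y -> Num.max 0 (x - y) = 0.
Proof. by move=> xy; apply/max_idPl; rewrite subr_le0. Qed.

Section sample_cost.
Context (R : realType) (n : nat) (tau : nat -> nat -> R) (b : nat -> R).
Implicit Types (i j k c l : nat) (s : R).

Local Notation arr := (arrival tau b).
Local Notation dep := (departure tau b).
Local Notation start := (service_start tau b).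

Hypothesis tau_ge0 : forall j k, 0 <= tau j k.
Hypothesis b_gt0 : forall j, (1 <= j <= n)%N -> 0 < b j.

(** If a client is present but not yet in service, its predecessor is still present. The descent
    ends at a client in service, at the latest client 1, who is served on arrival. *)
Lemma not_idle j s : (1 <= j <= n)%N -> arr j <= s < dep j -> ~~ idle n tau b s.
Proof.
elim: j => // j IH j_n /andP[h1 h2]; rewrite negbK.
have [h|h] := leP (start j.+1) s.
  by apply/hasP; exists j.+1; rewrite ?mem_iota ?/in_service ?h ?h2//; lia.
have j0 : (0 < j)%N.
  rewrite lt0n; apply: contraTN h => /eqP j0; move: h1.
  have dep0 : dep 0 = arr 1 by [].
  by rewrite j0 -leNgt service_startS ge_max dep0 => ->.
rewrite -[has _ _]negbK; apply: IH; first lia.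
rewrite (le_trans (arrival_le b tau_ge0 (j := j.+1) _) h1) ?leqnSn ?j0//=.
by move: h; rewrite service_startS lt_max ltNge h1.
Qed.

Lemma idle_after j s : (1 <= j < n)%N -> dep j <= s < arr j.+1 -> idle n tau b s.
Proof.
move=> j_n /andP[h1 h2]; apply/hasPn => i; rewrite mem_iota => i_n.
rewrite /in_service negb_and -leNgt -ltNge; have [ij|ji] := leqP i j.
  by rewrite (le_trans _ h1) ?orbT// (departure_le tau b_gt0)//; lia.
rewrite (lt_le_trans h2)// (le_trans _ (arrival_le_start tau b i))//.
by apply: arrival_le => //; lia.
Qed.

Let idle_set i := `[arr i, arr n] `&` [set s | idle n tau b s].

Lemma measure_idle q i : (1 <= i)%N -> (i + q = n)%N ->
  measurable (idle_set i) /\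
  lebesgue_measure (idle_set i) = (\sum_(i <= j < n) Num.max 0 (arr j.+1 - dep j))%:E.
Proof.
elim: q i => [|q IH] i i1 iq.
  have in_ : i = n by lia.
  (* The interval is the single arrival time of client n, at which the server is busy. *)
  suff -> : idle_set i = set0 by rewrite measure0 in_ big_geq//; split.
  apply/seteqP; split => // s [/=]; rewrite in_itv/= in_ -eq_le => /eqP <-.
  apply/negP; apply: (not_idle (j := n)); first lia.
  by rewrite lexx (arrival_lt_departure tau b_gt0)//; lia.
have [mI lI] := IH i.+1 ltac:(lia) ltac:(lia).
have split_idle : idle_set i = `[dep i, arr i.+1[ `|` idle_set i.+1.
  apply/seteqP; split => s /=; rewrite /idle_set /= !in_itv/=.
    move=> [/andP[h1 h2] h3]; have [h4|h4] := ltP s (arr i.+1).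
      left; rewrite andbT leNgt; apply/negP => h5.
      by move: h3; apply/negP; apply: (not_idle (j := i)); [lia|rewrite h1 h5].
    by right; rewrite h2.
  move=> [/andP[h1 h2]|[/andP[h1 h2] h3]].
    rewrite (le_trans _ h1)/=; last by rewrite ltW// (arrival_lt_departure tau b_gt0)//; lia.
    rewrite (le_trans (ltW h2))/=; last by apply: arrival_le => //; lia.
    by split => //; apply: (idle_after (j := i)); [lia|rewrite h1 h2].
  rewrite h2 andbT; split => //.
  by rewrite (le_trans _ h1)//; apply: arrival_le => //; lia.
have disj : [disjoint (`[dep i, arr i.+1[%classic : set R) & idle_set i.+1].
  apply/disj_setPS => s [/=]; rewrite in_itv/= => /andP[_ h1] [].
  by rewrite /= in_itv/= leNgt h1.
rewrite split_idle; split; first exact: measurableU.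
rewrite measureU//; last exact/disj_set2P.
rewrite big_ltn; last lia.
rewrite EFinD -lI; congr (_ + _)%E.
exact: lebesgue_measure_co.
Qed.

Lemma start_le_departure_n j : (1 <= j <= n)%N -> start j <= dep n.
Proof.
move=> j_n; rewrite (le_trans (ltW (start_lt_departure tau b_gt0 j_n)))//.
by apply: (departure_le tau b_gt0); lia.
Qed.

Lemma nb_waitingE s : (nb_waiting n tau b s)%:R =
  \sum_(j <- iota 1 n) (\1_(`[arr j, start j[%classic) s : R).
Proof.
rewrite /nb_waiting -sum1_count natr_sum big_mkcond/= big_seq [RHS]big_seq.
apply: eq_bigr => j; rewrite mem_iota => j_n.
rewrite indicE mem_setE in_itv/= /present /in_service.
have h := start_lt_departure tau b_gt0 (i := j) ltac:(lia).
have -> : (arr j <= s < dep j) && ~~ (start j <= s < dep j) = (arr j <= s < start j).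
  rewrite negb_and -ltNge -leNgt; have [h1|h1] := ltP s (start j).
    by rewrite (lt_trans h1 h) !andbT.
  by rewrite !andbF /=; case: (ltP s (dep j)) => h2; rewrite ?andbF// leNgt h2 andbF.
by case: ifP.
Qed.

Lemma integral_nb_waiting i : (1 <= i <= n)%N ->
  (\int[lebesgue_measure]_(s in `[arr i, dep n]) (nb_waiting n tau b s)%:R%:E =
   (\sum_(j <- iota 1 n) Num.max 0 (start j - Num.max (arr j) (arr i)))%:E)%E.
Proof.
move=> i_n.
under eq_integral do rewrite nb_waitingE -sumEFin.
rewrite ge0_integral_sum//; last first.
  by move=> j; apply/measurable_EFinP; exact: measurable_indic.
rewrite -sumEFin big_seq [RHS]big_seq; apply: eq_bigr => j; rewrite mem_iota => j_n.
rewrite integral_indic//.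
have -> : `[arr j, start j[ `&` `[arr i, dep n] = `[Num.max (arr j) (arr i), start j[%classic.
  apply/seteqP; split => s /=; rewrite !in_itv/= ge_max.
    by move=> [/andP[-> ->] /andP[-> _]].
  move=> /andP[/andP[-> ->] h]; rewrite h; split => //=.
  by rewrite (le_trans (ltW h))// start_le_departure_n//; lia.
exact: lebesgue_measure_co.
Qed.

Variable omega : R.

Definition sample_cost i : R :=
  omega * \sum_(i <= j < n) Num.max 0 (arr j.+1 - dep j) +
  (1 - omega) * \sum_(j <- iota 1 n) Num.max 0 (start j - Num.max (arr j) (arr i)).

Lemma cost_sample_cost i : (1 <= i <= n)%N -> cost n omega tau i b = (sample_cost i)%:E.
Proof.
move=> i_n; rewrite /cost integral_nb_waiting//.
have [_ ->] := @measure_idle (n - i)%N i ltac:(lia) ltac:(lia).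
by rewrite -!EFinM -EFinD.
Qed.

Section state.
Variables (i k : nat) (v : nat -> R).
Hypotheses (i_n : (1 <= i <= n)%N) (st : in_state n tau b i k v).

Lemma start_le_arrival j : (1 <= j <= (i - k).+1)%N -> start j <= arr i.
Proof.
have ki := in_state_nb b_gt0 i_n st; have [nbk _ _] := st.
case: j => // j jm; rewrite service_startS ge_max arrival_le//=; last lia.
have /andP[h _] := departure_nb tau_ge0 b_gt0 i_n.
by rewrite (le_trans _ h)// (departure_le tau b_gt0)// nbk; lia.
Qed.

Lemma sum_waiting_times (F G : nat -> R) :
  (forall j, (1 <= j <= (i - k).+1)%N -> F j = 0) ->
  (forall l, (1 <= l < k)%N -> F ((i - k).+1 + l)%N = G l) ->
  (forall j, (i < j <= n)%N -> F j = 0) ->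
  \sum_(j <- iota 1 n) F j = \sum_(1 <= l < k) G l.
Proof.
have ki := in_state_nb b_gt0 i_n st.
move=> F1 F2 F3.
have -> : iota 1 n = index_iota 1 n.+1 by rewrite /index_iota subSS subn0.
rewrite (big_cat_nat (n := (i - k).+2))/=; [|lia|lia].
rewrite big_nat_cond big1 ?add0r; last by move=> j; rewrite andbT => jm; apply: F1; lia.
rewrite (big_cat_nat (n := i.+1))/=; [|lia|lia].
rewrite [X in _ + X]big_nat_cond [X in _ + X]big1 ?addr0; last first.
  by move=> j; rewrite andbT => jm; apply: F3; lia.
rewrite -{1}[(i - k).+2]add1n big_addn (_ : i.+1 - (i - k).+1 = k)%N; last lia.
by apply: eq_big_nat => l lk; rewrite addnC F2.
Qed.

(** The idle sum loses its first term. The waiting time of a client after arrival i, minus that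
    after arrival i + 1, is the minimum of a partial sum and the interarrival time. *)
Lemma sample_cost_next : (i < n)%N ->
  sample_cost i = stage_cost omega tau i k v + sample_cost i.+1.
Proof.
move=> i_lt_n; have ki := in_state_nb b_gt0 i_n st; have [nbk _ _] := st.
have aS : arr i.+1 = arr i + tau i k by rewrite arrivalS ?nbk//; lia.
rewrite /sample_cost /stage_cost big_ltn//.
have -> : dep i = arr i + psum (i - k).+1 k v.
  by rewrite (in_state_psum tau_ge0 b_gt0 i_n st) ?subnK//; lia.
rewrite aS opprD addrACA subrr add0r.
have -> : \sum_(j <- iota 1 n) Num.max 0 (start j - Num.max (arr j) (arr i)) =
    \sum_(j <- iota 1 n) Num.max 0 (start j - Num.max (arr j) (arr i.+1)) +
    \sum_(1 <= l < k) Num.min (psum (i - k).+1 l v) (tau i k).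
  rewrite -(@sum_waiting_times (fun j => Num.max 0 (start j - Num.max (arr j) (arr i)) -
      Num.max 0 (start j - Num.max (arr j) (arr i.+1)))).
  - by rewrite -big_split/=; apply: eq_bigr => j _; rewrite addrC subrK.
  - move=> j jm; have h := start_le_arrival jm.
    have h' := arrival_le b tau_ge0 (i := i) (j := i.+1) ltac:(lia).
    by rewrite !max0_subr_le ?subrr// le_max ?h ?(le_trans h h') ?orbT.
  - move=> l lk; rewrite -(in_state_psum_start tau_ge0 b_gt0 i_n st lk).
    have h1 : arr ((i - k).+1 + l) <= arr i by apply: arrival_le => //; lia.
    have h2 : arr i <= arr i.+1 by apply: arrival_le => //; lia.
    rewrite (max_idPr h1) (max_idPr (le_trans h1 h2)) aS.
    have := psum_ge0 (i - k).+1 l v; have := tau_ge0 i k.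
    move: (psum _ _ _) (tau _ _) (arr i) => x y a y0 x0.
    have -> : a + x - a = x by ring.
    have -> : a + x - (a + y) = x - y by ring.
    rewrite (max_idPr x0).
    have [h|h] := leP x y; first by rewrite max0_subr_le// subr0.
    by rewrite (max_idPr _) ?subr_ge0 ?(ltW h)//; ring.
  - move=> j jn; have h : arr i <= arr j by apply: arrival_le => //; lia.
    have h' : arr i.+1 <= arr j by apply: arrival_le => //; lia.
    by rewrite (max_idPl h) (max_idPl h') subrr.
rewrite -aS; ring.
Qed.

End state.

Lemma sample_cost_final k v : (1 <= n)%N -> in_state n tau b n k v ->
  sample_cost n = final_cost n omega k v.
Proof.
move=> n1 st; have n_n : (1 <= n <= n)%N by rewrite n1 leqnn.
have ki := in_state_nb b_gt0 n_n st.
rewrite /sample_cost /final_cost big_geq// mulr0 add0r; congr (_ * _).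
apply: (sum_waiting_times n_n st).
- move=> j jm; have h := start_le_arrival n_n st jm.
  by rewrite max0_subr_le// le_max h orbT.
- move=> l lk; rewrite -(in_state_psum_start tau_ge0 b_gt0 n_n st lk).
  have h1 : arr ((n - k).+1 + l) <= arr n by apply: arrival_le => //; lia.
  by rewrite (max_idPr h1) addrAC subrr add0r (max_idPr (psum_ge0 _ _ _)).
- by move=> j jn; lia.
Qed.

Lemma sample_cost_total q i k v : (1 <= i)%N -> (i + q = n)%N -> in_state n tau b i k v ->
  (sample_cost i)%:E = total tau (fun i k v => (stage_cost omega tau i k v)%:E)
    (fun k v => (final_cost n omega k v)%:E) q i k v.
Proof.
elim: q i k v => [|q IH] i k v i1 iq st.
  have e : i = n by lia.
  by move: st i1; rewrite e => st i1; rewrite /= (sample_cost_final _ st).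
rewrite /= -IH; [|lia|lia|by apply: in_state_next => //; lia].
by rewrite -EFinD -(sample_cost_next _ st)//; lia.
Qed.

End sample_cost.

(** * Conditional expected cost of a policy *)

(** The integral of an arbitrary nonnegative function is a supremum over the simple functions below
    it. *)
Lemma le_integralT_ge0 d (T : measurableType d) (R : realType) (P : {measure set T -> \bar R})
    (F G : T -> \bar R) :
  (forall x, 0 <= F x)%E -> (forall x, F x <= G x)%E ->
  (\int[P]_x F x <= \int[P]_x G x)%E.
Proof.
move=> F0 FG; have G0 x : (0 <= G x)%E by exact: le_trans (FG x).
rewrite !ge0_integralTE//; apply: ereal_sup_le => _ [h hF <-]; exists h => //= x.
exact: le_trans (hF x) (FG x).
Qed.

(* Used for the cost, whose measurability is not obvious: F is squeezed between
   two measurable functions that agree outside N. *)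
Lemma integral_eq_on_full d (T : measurableType d) (R : realType) (P : {measure set T ->
  \bar R})
    (N : set T) (F G : T -> \bar R) : measurable N -> P N = 0%E ->
  (forall x, 0 <= F x)%E -> (forall x, 0 <= G x)%E -> measurable_fun setT G ->
  (forall x, ~ N x -> F x = G x) -> (\int[P]_x F x = \int[P]_x G x)%E.
Proof.
move=> mN PN F0 G0 mG FG.
have mB : measurable_fun setT (fun x => x \in N).
  apply: (@measurable_fun_bool _ _ _ _ true); rewrite setTI.
  by rewrite (_ : _ @^-1` _ = N)//; apply/seteqP; split => x /=;
    [exact: set_mem|exact: mem_set].
pose G' (y : \bar R) x := if x \in N then y else G x.
have mG' y : measurable_fun setT (G' y).
  by apply: measurable_fun_if => //; exact: measurable_funTS.
have G'0 y : (0 <= y)%E -> forall x, (0 <= G' y x)%E.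
  by move=> y0 x; rewrite /G'; case: ifP.
have intG' y : (0 <= y)%E -> (\int[P]_x G' y x = \int[P]_x G x)%E.
  move=> y0; apply: ge0_ae_eq_integral => //; first by move=> x _; exact: G'0.
  exists N; split => // x /= /not_implyP[_]; rewrite /G'; case: ifPn => [/set_mem//|_]; by [].
apply/eqP; rewrite eq_le; apply/andP; split.
  rewrite -(intG' +oo%E)//; apply: le_integralT_ge0 => // x; rewrite /G'.
  by case: ifPn => [_|/negP xN]; [rewrite leey|rewrite FG// => /mem_set].
rewrite -(intG' 0%E)//; apply: le_integralT_ge0; first exact: G'0.
move=> x; rewrite /G'; case: ifPn => [_|/negP xN]; first exact: F0.
by rewrite FG// => /mem_set.
Qed.

Section state_measurability.
Context (R : realType) (n : nat) (tau : nat -> nat -> R).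
Local Notation Om := (services R n).

Let measurable_nb i :
  measurable_fun setT (fun b : Om => arrival tau b i : R) ->
  (forall j, (j <= i)%N -> measurable_fun setT (fun b : Om => departure tau b j : R)) ->
  forall k, measurable_fun setT (fun b : Om => nb_in_system tau b i == k).
Proof.
move=> ma md k.
have mn : measurable_fun setT (fun b : Om => (nb_in_system tau b i)%:R : R).
  have -> : (fun b : Om => (nb_in_system tau b i)%:R : R) =
      (fun b : Om => \sum_(1 <= j < i.+1) (if arrival tau b i < departure tau b j then 1
        else 0)).
    apply/funext => b; rewrite nb_count -sum1_count natr_sum big_mkcond/=.
    by rewrite /index_iota subSS subn0; apply: eq_bigr => j _; case: ifP.
  apply: measurable_sum_nat => j ji; apply: measurable_fun_if => //.
  by apply: measurable_fun_ltr => //; apply: md; lia.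
have -> : (fun b : Om => nb_in_system tau b i == k) =
    (fun b : Om => (nb_in_system tau b i)%:R == k%:R :> R).
  by apply/funext => b; rewrite eqr_nat.
exact: measurable_fun_eqr.
Qed.

Let measurable_history i : (i <= n)%N ->
  measurable_fun setT (fun b : Om => arrival tau b i : R) /\
  (forall j, (j <= i)%N -> measurable_fun setT (fun b : Om => departure tau b j : R)).
Proof.
elim: i => [_|i IH i_n]; first by split => // -[].
have [ma md] := IH (ltnW i_n).
have maS : measurable_fun setT (fun b : Om => arrival tau b i.+1 : R).
  case: i => [|i] in IH i_n ma md *; first by [].
  (* [tau] is evaluated at a random count with finitely many values, so its value is a finite sum
     over these. *)
  have -> : (fun b : Om => arrival tau b i.+2) =
      (fun b : Om => arrival tau b i.+1 + \sum_(0 <= k < i.+2)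
         (if nb_in_system tau b i.+1 == k then tau i.+1 k else 0)).
    apply/funext => b; rewrite arrivalS//; congr (_ + _).
    have nbi := nb_le tau b i.+1.
    rewrite big_mkord (bigD1 (Ordinal (nbi : (nb_in_system tau b i.+1 < i.+2)%N)))//= eqxx.
    by rewrite big1 ?addr0// => k; rewrite -val_eqE/= eq_sym => /negbTE ->.
  apply: measurable_funD => //; apply: measurable_sum_nat => k _.
  by apply: measurable_fun_if => //; exact: measurable_nb.
split => // j; rewrite leq_eqVlt => /predU1P[->|]; last by rewrite ltnS; exact: md.
have -> : (fun b : Om => departure tau b i.+1) =
    (fun b : Om => Num.max (arrival tau b i.+1) (departure tau b i) + b i.+1).
  by apply/funext => b; exact: departureS.
apply: measurable_funD; last by apply: measurable_coord; lia.
by apply: measurable_maxr => //; exact: md.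
Qed.

Lemma measurable_nb_in_system i k : (i <= n)%N ->
  measurable [set b : Om | nb_in_system tau b i = k].
Proof.
move=> i_n; have [ma md] := measurable_history i_n.
have := measurable_nb ma md k measurableT (Y := [set true]) I.
rewrite setTI (_ : _ @^-1` _ = [set b : Om | nb_in_system tau b i = k])//.
by apply/seteqP; split => b /=; [move/eqP|move=> ->; rewrite eqxx].
Qed.

End state_measurability.

Section reaching_a_state.
Context (R : realType) (n : nat) (mu : nat -> R) (tau : nat -> nat -> R).
Variables (Q : probability (services R n) R).

(* The probability that there are k0 clients after the arrival of client i + s,
   given that there are k after the arrival of client i. *)
Fixpoint reach (s i k k0 : nat) : R :=
  if s is s'.+1 then
    \sum_(0 <= c < k.+1) step_prob mu (i - k).+1 k c (tau i k) * reach s' i.+1 (k.+1 - c) k0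
  else (k == k0)%:R.

(** Each step renews the law of the vector, so the number of clients reached and the vector there
    contribute separate factors. *)
Lemma mean_total_reach (h : (nat -> R) -> \bar R) (y : R) k0 s i k :
  (\int[Q]_(b in [set: services R n]) h b = y%:E)%E ->
  mean_total tau mu Q (fun _ _ _ => 0%E) (fun k b => if k == k0 then h b else 0%E) s i k =
  (reach s i k k0 * y)%:E.
Proof.
move=> hy; elim: s i k => [|s IH] i k /=.
  by case: eqP => _; rewrite ?integral0 ?mul1r ?mul0r.
rewrite integral0 add0e mulr_suml -sumEFin; apply: eq_bigr => c _.
by rewrite IH -mulrA EFinM.
Qed.

End reaching_a_state.

Lemma cost_ge0 (R : realType) n (omega : R) tau i b : 0 <= omega <= 1 ->
  (0 <= cost n omega tau i b)%E.
Proof.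
move=> /andP[w0 w1]; apply: adde_ge0; apply: mule_ge0.
- by rewrite lee_fin.
- exact: measure_ge0.
- by rewrite lee_fin subr_ge0.
- by apply: integral_ge0 => s _; rewrite lee_fin.
Qed.

Section conditional_cost.
Context (R : realType) (n : nat) (mu : nat -> R).
Context (d : measure_display) (T : measurableType d) (P : probability T R).
Variable B : nat -> {RV P >-> R}.
Hypothesis mu_gt0 : forall i, (1 <= i <= n)%N -> 0 < mu i.
Hypothesis mu_distinct : forall i j, (1 <= i <= n)%N -> (1 <= j <= n)%N ->
  mu i = mu j -> i = j.
Hypothesis B_indep : mutually_independent n B.
Hypothesis B_exp : forall i, (1 <= i <= n)%N -> exponentially_distributed (mu i) (B i).

Let Bv (x : T) : services R n := fun j => B j x.

Lemma measurable_service_vector : measurable_fun setT Bv.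
Proof. by apply: measurable_fun_services => // j _; exact: measurable_funPT. Qed.

Let Bm : {mfun T >-> services R n} :=
  HB.pack Bv (isMeasurableFun.Build _ _ _ _ _ measurable_service_vector).

Let Q : probability (services R n) R := distribution P Bm.

Let E j : probability R R := distribution P (B j).

Let Q_cyl A : (forall j, measurable (A j)) ->
  Q (cylinder n A) = (\prod_(j <- iota 1 n) E j (A j))%E.
Proof.
move=> mA; rewrite -(B_indep (J := iota 1 n) (A := A))//; last 2 first.
- exact: iota_uniq.
- by move=> j; rewrite mem_iota; lia.
rewrite /Q /= /distribution /pushforward; congr (P _).
apply/seteqP; split => x /= h j.
  by rewrite /= mem_iota => jn; apply: h; lia.
by move=> jn; apply: h; rewrite /= mem_iota; lia.
Qed.

Let E_exp j : (1 <= j <= n)%N -> forall A : set R, measurable A ->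
  E j A = exponential_prob (mu j) A.
Proof. by move=> jn A mA; exact: B_exp. Qed.

(** The null event that some service time is not positive, outside which the path lemmas apply. *)
Let N : set T :=
  \bigcup_j (if (1 <= j <= n)%N then B j @^-1` `]-oo, 0%R] else set0).

Let measurable_N : measurable N.
Proof. by apply: bigcupT_measurable => j; case: ifP => // _; exact: measurable_funPTI. Qed.

Let P_N : P N = 0%E.
Proof.
apply: measure_negligible => //; apply: negligible_bigcup => j; case: ifP => jn;
  last exact: negligible_set0.
apply/negligibleP; first exact: measurable_funPTI.
exact: (exp_law_le0 (E_exp jn)).
Qed.

Let off_N x : ~ N x -> forall j, (1 <= j <= n)%N -> 0 < Bv x j.
Proof.
move=> xN j jn; rewrite ltNge; apply/negP => Bj; apply: xN; exists j => //.
by rewrite jn /= in_itv.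
Qed.

Section policy.
Variable tau : nat -> nat -> R.
Hypothesis tau_ge0 : forall j k, 0 <= tau j k.
Variables i k : nat.
Hypotheses (i_n : (i <= n)%N) (ki : (1 <= k <= i)%N).

Let at_state h (k' : nat) (b : nat -> R) : \bar R := if k' == k then h b else 0%E.

(** [F] evaluates [h] at the state reached at client i if k clients are present, and is 0 otherwise.
    The choice h = 1 gives the probability of the conditioning event, the cost to go gives the cost
    on it. *)
Let at_state_total h y : future_function n i k h ->
  (\int[Q]_(b in [set: services R n]) h b = y%:E)%E ->
  let F := total tau (fun _ _ _ => 0%E) (at_state h) i.-1 1 1 in
  [/\ measurable_fun [set: T] (F \o Bv), forall b, (0 <= F b)%E &
      (\int[P]_x F (Bv x) = (reach mu tau i.-1 1 1 k * y)%:E)%E].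
Proof.
move=> fh hy F.
have st0 j l : (1 <= l <= j)%N -> (j <= n)%N -> future_function n j l (fun=> 0%E : \bar R).
  by move=> _ _; split.
have fin_future l : (1 <= l <= 1 + i.-1)%N -> future_function n (1 + i.-1) l (at_state h l).
  rewrite add1n prednK; last lia.
  by move=> li; rewrite /at_state; case: eqP => [->|_] //; split.
have [[mF F0 _] intF] := total_future tau_ge0 Q_cyl mu_gt0 mu_distinct E_exp
  st0 (s := i.-1) (i := 1%N) (k := 1%N) isT ltac:(lia) fin_future.
split; first exact: (measurableT_comp mF measurable_service_vector).
  exact: F0.
rewrite -(mean_total_reach mu tau k i.-1 1 1 hy) -intF.
by rewrite [RHS]ge0_integral_pushforward//; exact: measurable_service_vector.
Qed.

Let in_state_off_N x : ~ N x ->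
  let r := run tau i.-1 1 1 (Bv x) in in_state n tau (Bv x) i r.1 r.2.
Proof.
move=> /off_N b_gt0 r.
have n1 : (1 <= n)%N by lia.
have := in_state_run tau_ge0 b_gt0 (q := i.-1) (i := 1%N) isT ltac:(lia) (in_state1 tau
  b_gt0 n1).
by rewrite add1n prednK//; lia.
Qed.

Lemma measurable_state_event : measurable (state_event B tau i k).
Proof.
have := measurable_service_vector measurableT (measurable_nb_in_system tau k i_n).
by rewrite setTI.
Qed.

Lemma probability_state_event :
  P (state_event B tau i k) = (reach mu tau i.-1 1 1 k)%:E.
Proof.
have f1 : future_function n i k (fun=> 1%E : \bar R) by split.
have int1 : (\int[Q]_(b in [set: services R n]) (fun=> 1%E) b = 1%:E :> \bar R)%E.
  by rewrite integral_cst// mul1e; exact: probability_setT.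
have [mF F0 intF] := at_state_total f1 int1.
rewrite -[state_event _ _ _ _]setIT -integral_indic//; last exact: measurable_state_event.
rewrite mulr1 in intF; rewrite -intF.
apply: (integral_eq_on_full measurable_N P_N) => //.
move=> x xN; have [nbk _ _] := in_state_off_N xN.
rewrite total_run /at_state -nbk indicE.
have -> : (x \in state_event B tau i k) = (nb_in_system tau (Bv x) i == k).
  by apply/idP/eqP => [/set_mem//|h]; apply/mem_set.
by case: eqP.
Qed.

Variable omega : R.
Hypothesis omega01 : 0 <= omega <= 1.

Let stage i k b := (stage_cost omega tau i k b)%:E.
Let final k b := (final_cost n omega k b)%:E.

Lemma integral_cost_state_event :
  (\int[P]_(x in state_event B tau i k) cost n omega tau i (fun j => B j x) =
   (reach mu tau i.-1 1 1 k * policy_value n mu omega tau (n - i) i k)%:E)%E.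
Proof.
pose h := total tau stage final (n - i) i k.
have stf j l : (1 <= l <= j)%N -> (j <= n)%N -> future_function n j l (stage j l).
  by move=> lj jn; exact: stage_cost_future.
have finf l : (1 <= l <= i + (n - i))%N -> future_function n (i + (n - i)) l (final l).
  by rewrite subnKC// => ln; exact: final_cost_future.
have [fh] := total_future tau_ge0 Q_cyl mu_gt0 mu_distinct E_exp
  stf (s := (n - i)%N) ki ltac:(lia) finf.
rewrite (mean_total_cost tau_ge0 omega01 Q_cyl mu_gt0 mu_distinct E_exp)//; last exact: subnKC.
move=> hy; have [mF F0 intF] := at_state_total fh hy.
rewrite -intF integral_mkcond.
apply: (integral_eq_on_full measurable_N P_N) => //.
  by move=> x; rewrite patchE; case: ifP => // _; exact: cost_ge0.
move=> x xN; have st := in_state_off_N xN; have [nbk _ _] := st.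
rewrite total_run /at_state patchE.
have -> : (x \in state_event B tau i k) = (nb_in_system tau (Bv x) i == k).
  by apply/idP/eqP => [/set_mem//|h']; apply/mem_set.
rewrite nbk; case: eqP => // rk.
have b_gt0 := off_N xN; have i1 : (1 <= i)%N by lia.
rewrite (cost_sample_cost tau_ge0 b_gt0) ?i1// /h -rk.
by apply: (sample_cost_total tau_ge0 b_gt0) => //; exact: subnKC.
Qed.

Lemma cond_expectation_cost : 0 < reach mu tau i.-1 1 1 k ->
  cond_expectation P (fun x => cost n omega tau i (fun j => B j x)) (state_event B tau i k) =
  (policy_value n mu omega tau (n - i) i k)%:E.
Proof.
move=> r0; rewrite /cond_expectation integral_cost_state_event probability_state_event.
rewrite inver gt_eqF// -EFinM mulrAC divff ?mul1r// gt_eqF//.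
Qed.

End policy.

End conditional_cost.

(** * Dynamic programming *)

(** With the integrating factor e^{Ms}, the derivative is positive for s > 0. This yields the signs
    of the explicit sums of exponentials; M = 0 covers plain antiderivatives. *)
Lemma linear_ode_gt0 (R : realType) (M : R) (y w : R -> R) (t : R) :
  (forall s : R, is_derive s 1 y (w s - M * y s)) -> y 0 = 0 ->
  (forall s, 0 < s -> 0 < w s) -> 0 < t -> 0 < y t.
Proof.
move=> dy y0 w0 t0.
pose F (s : R) : R := expR (M * s) * y s.
have dF (s : R) : is_derive s 1 F (expR (M * s) * w s).
  have := is_deriveM (is_derive_expM M s) (dy s).
  by rewrite /GRing.scale/= (_ : _ + _ = expR (M * s) * w s)//; ring.
have cF : {within `[0, t], continuous F}.
  apply: continuous_subspaceT => s; apply: differentiable_continuous.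
  by apply/derivable1_diffP; exact: (ex_derive (is_derive := dF s)).
have [s s0 Fs] := MVT t0 (fun s _ => dF s) cF.
have F0 : F 0 = 0 by rewrite /F y0 mulr0.
have : 0 < F t.
  move: Fs; rewrite F0 !subr0 => ->; move: s0; rewrite in_itv/= => /andP[s0 _].
  by rewrite !mulr_gt0 ?expR_gt0 ?w0.
by rewrite /F pmulr_rgt0// expR_gt0.
Qed.

Section positivity.
Context (R : realType) (n : nat) (mu : nat -> R).
Hypothesis mu_gt0 : forall i, (1 <= i <= n)%N -> 0 < mu i.
Hypothesis mu_distinct : forall i j, (1 <= i <= n)%N -> (1 <= j <= n)%N ->
  mu i = mu j -> i = j.
Variables (m : nat) (m1 : (1 <= m)%N).

Let good l : (m + l <= n)%N -> distinct_rates mu m l := distinct_rates_le mu_gt0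
  mu_distinct m1.

Lemma sumcdf_gt0 l (t : R) : (m + l <= n.+1)%N -> 0 < t -> 0 < sumcdf mu m l t.
Proof.
elim: l t => [|l IH] t ml t0; first exact: ltr01.
have gl : distinct_rates mu m l by apply: good; lia.
apply: (@linear_ode_gt0 _ (mu (m + l)%N) _ (fun s => mu (m + l)%N * sumcdf mu m l s)) => //.
- by move=> s; rewrite -mulrBr; exact: is_derive_sumcdf.
- exact: sumcdf0.
- by move=> s s0; rewrite mulr_gt0 ?mu_gt0 ?IH//; lia.
Qed.

(** Each difference solves a linear equation driven by the previous one, so positivity propagates
    from the exponential at c = 0. *)
Lemma sumcdf_decr c (t : R) : (m + c <= n)%N -> 0 < t -> sumcdf mu m c.+1 t < sumcdf mu m c t.
Proof.
move=> mc t0; rewrite -subr_gt0; elim: c t mc t0 => [|c IH] t mc t0.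
  rewrite sumcdf_sub; last exact: good.
  rewrite addn0 /phi addn0 big_nat1 /= eqxx mulrAC divff ?mul1r ?expR_gt0// gt_eqF//
    mu_gt0//; lia.
have gc : distinct_rates mu m c by apply: good; lia.
have gc1 : distinct_rates mu m c.+1 by exact: good.
apply: (@linear_ode_gt0 _ (mu (m + c.+1)%N) (fun s => sumcdf mu m c.+1 s - sumcdf mu m c.+2 s)
  (fun s => mu (m + c)%N * (sumcdf mu m c s - sumcdf mu m c.+1 s))) => //.
- move=> s; exact: (is_deriveB (is_derive_sumcdf s gc) (is_derive_sumcdf s gc1)).
- by rewrite !sumcdf0// subrr.
- by move=> s s0; rewrite mulr_gt0 ?mu_gt0 ?IH//; lia.
Qed.

Lemma sumcdf_lt1 c (t : R) : (m + c <= n)%N -> 0 < t -> sumcdf mu m c.+1 t < 1.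
Proof.
elim: c => [|c IH] mc t0; first exact: (sumcdf_decr mc t0).
by rewrite (lt_trans (sumcdf_decr mc t0))// IH//; lia.
Qed.

Lemma step_prob_gt0 k c (t : R) : (m + k <= n.+1)%N -> (c <= k)%N -> 0 < t ->
  0 < step_prob mu m k c t.
Proof.
move=> mk ck t0; rewrite /step_prob; case: eqP => ck'; first exact: sumcdf_gt0.
by rewrite subr_gt0 sumcdf_decr//; lia.
Qed.

Lemma step_prob_ge0 k c (t : R) : (m + k <= n.+1)%N -> (c <= k)%N -> 0 <= t ->
  0 <= step_prob mu m k c t.
Proof.
move=> mk ck; rewrite le_eqVlt => /predU1P[<-|t0]; last exact/ltW/step_prob_gt0.
have s0 l : (m + l <= n)%N -> sumcdf mu m l.+1 0 = 0 by move=> ml; apply: sumcdf0; exact: good.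
rewrite /step_prob; case: eqP => ck'.
  by case: (k) mk => [_|l ml]; [exact: ler01|rewrite s0//; lia].
rewrite (s0 c) ?subr0; last lia.
case: c ck ck' => [|c] ck ck'; first exact: ler01.
by rewrite s0//; lia.
Qed.

Lemma slack_ge0 l (t : R) : (m + l <= n.+1)%N -> 0 <= t -> 0 <= slack mu m l t.
Proof.
move=> ml; rewrite le_eqVlt => /predU1P[<-|t0]; first by rewrite slack0.
apply/ltW/(@linear_ode_gt0 _ 0 _ (sumcdf mu m l)) => //.
- move=> s; rewrite mul0r subr0; apply: is_derive_slack.
  by case: l ml => // l ml; apply: good; lia.
- exact: slack0.
- by move=> s s0; exact: sumcdf_gt0.
Qed.

Lemma slack_le l (t : R) : (m + l <= n.+1)%N -> 0 <= t -> slack mu m l t <= t.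
Proof.
case: l => // l ml; rewrite le_eqVlt => /predU1P[<-|t0]; first by rewrite slack0.
rewrite -subr_ge0; apply/ltW.
have gl : distinct_rates mu m l by apply: good; lia.
apply: (@linear_ode_gt0 _ 0 (fun s => s - slack mu m l.+1 s) (fun s =>
  1 - sumcdf mu m l.+1 s)) => //.
- move=> s; rewrite mul0r subr0.
  exact: (is_deriveB (is_derive_id s 1) (is_derive_slack s (m := l.+1) gl)).
- by rewrite slack0 subr0.
- by move=> s s0; rewrite subr_gt0 sumcdf_lt1//; lia.
Qed.

End positivity.

(** * Bellman operator and almost optimal policies *)

Section dynamic_programming.
Context (R : realType) (n : nat) (mu : nat -> R) (omega : R).
Hypothesis mu_gt0 : forall i, (1 <= i <= n)%N -> 0 < mu i.
Hypothesis mu_distinct : forall i j, (1 <= i <= n)%N -> (1 <= j <= n)%N ->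
  mu i = mu j -> i = j.
Implicit Types (s i k l : nat) (t : R).

Lemma p_ge0 i k l t : (1 <= k <= i)%N -> (i <= n)%N -> (1 <= l <= k.+1)%N -> 0 <= t ->
  0 <= p mu k l i t.
Proof.
move=> ki i_n lk t0; rewrite (_ : l = k.+1 - (k.+1 - l))%N; last lia.
rewrite (p_step_prob mu_gt0 mu_distinct)//; last lia.
by apply: (step_prob_ge0 mu_gt0 mu_distinct) => //; lia.
Qed.

Lemma sum_p1 i k t : (1 <= k <= i)%N -> (i <= n)%N -> \sum_(1 <= l < k.+2) p mu k l i t = 1.
Proof.
move=> ki i_n; under eq_bigr do rewrite -[p _ _ _ _ _]mulr1.
rewrite (sum_p mu_gt0 mu_distinct t (fun=> 1))//.
by under eq_bigr do rewrite mulr1; exact: sum_step_prob.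
Qed.

Lemma eq_policy_value tau tau' s i k : (forall j l, (i <= j)%N -> tau j l = tau' j l) ->
  policy_value n mu omega tau s i k = policy_value n mu omega tau' s i k.
Proof.
elim: s i k => //= s IH i k tt'; rewrite tt'//; congr (_ + _); apply: eq_bigr => l _.
by rewrite (IH i.+1)// => j l' ij; apply: tt'; exact: ltnW.
Qed.

Lemma reach_ge0 tau s i k k0 : (forall j l, 0 <= tau j l) -> (1 <= k <= i)%N -> (i + s <=
  n)%N ->
  0 <= reach mu tau s i k k0.
Proof.
move=> tau0; elim: s i k => [|s IH] i k ki isn /=; first by case: eqP.
rewrite big_nat_cond; apply: sumr_ge0 => c; rewrite andbT => ck.
apply: mulr_ge0; last by apply: IH; lia.
by apply: (step_prob_ge0 mu_gt0 mu_distinct) => //; lia.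
Qed.

Lemma reach_gt0 tau s i k k0 : (forall j l, 0 <= tau j l) -> (1 <= k <= i)%N -> (i + s <=
  n)%N ->
  (forall j l, (j < i + s)%N -> 0 < tau j l) ->
  (if s == 0%N then k0 == k else (1 <= k0 <= k + s)%N) -> 0 < reach mu tau s i k k0.
Proof.
move=> tau0; elim: s i k => [|s IH] i k ki isn taup /=; first by move=> /eqP ->; rewrite eqxx.
move=> k0k.
(* One path to the target: nobody leaves until the last period, in which exactly the surplus
   leaves. *)
pose c := if s == 0%N then (k.+1 - k0)%N else 0%N.
have ck : (c < k.+1)%N by rewrite /c; case: ifP => // s0; lia.
rewrite big_mkord (bigD1 (Ordinal ck))//= ltr_wpDr//.
  apply: sumr_ge0 => j _; have jk := ltn_ord j; apply: mulr_ge0.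
    by apply: (step_prob_ge0 mu_gt0 mu_distinct) => //; lia.
  by apply: reach_ge0 => //; lia.
apply: mulr_gt0.
  by apply: (step_prob_gt0 mu_gt0 mu_distinct) => //; [lia|apply: taup; lia].
apply: IH; [lia|lia|by move=> j l jl; apply: taup; lia|].
move: ck; rewrite /c => {c} _.
by move: k0k; case: (s) => [|q] /= k0k; [apply/eqP|]; lia.
Qed.

Hypothesis omega01 : 0 <= omega <= 1.

Lemma stage_value_ge0 i k t : (1 <= k <= i)%N -> (i <= n)%N -> 0 <= t ->
  0 <= stage_value mu omega i k t.
Proof.
move=> ki i_n t0; case/andP: omega01 => w0 w1.
have good : distinct_rates mu (i - k).+1 k.-1.
  by apply: (distinct_rates_le mu_gt0 mu_distinct) => //; lia.
rewrite /stage_value f_slack// g_slack//; apply: addr_ge0; apply: mulr_ge0 => //.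
- by apply: (slack_ge0 mu_gt0 mu_distinct) => //; lia.
- by rewrite subr_ge0.
- rewrite big_nat_cond; apply: sumr_ge0 => l; rewrite andbT => lk.
  by rewrite subr_ge0 (slack_le mu_gt0 mu_distinct)//; lia.
Qed.

Lemma final_value_ge0 k : (1 <= k <= n)%N -> 0 <= final_value n mu omega k.
Proof.
move=> kn; case/andP: omega01 => w0 w1; apply: mulr_ge0; first by rewrite subr_ge0.
rewrite big_nat_cond; apply: sumr_ge0 => l; rewrite andbT => lk.
by rewrite mulr_ge0// invr_ge0 ltW// mu_gt0//; lia.
Qed.

Definition bellman (next : nat -> R) i k t : R :=
  stage_value mu omega i k t + \sum_(1 <= l < k.+2) p mu k l i t * next l.

Fixpoint opt s i k : R :=
  if s is s'.+1 then inf [set bellman (opt s' i.+1) i k t | t in [set t | 0 <= t]]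
  else final_value n mu omega k.

Lemma bellman_le next next' i k t : (1 <= k <= i)%N -> (i <= n)%N -> 0 <= t ->
  (forall l, (1 <= l <= k.+1)%N -> next l <= next' l) ->
  bellman next i k t <= bellman next' i k t.
Proof.
move=> ki i_n t0 le; rewrite /bellman lerD2l big_nat_cond [X in _ <= X]big_nat_cond;
  apply: ler_sum => l; rewrite andbT => lk.
by apply: ler_wpM2l; [apply: p_ge0|apply: le; lia].
Qed.

Lemma bellman_ge0 next i k t : (1 <= k <= i)%N -> (i <= n)%N -> 0 <= t ->
  (forall l, (1 <= l <= k.+1)%N -> 0 <= next l) -> 0 <= bellman next i k t.
Proof.
move=> ki i_n t0 n0; apply: addr_ge0; first exact: stage_value_ge0.
rewrite big_nat_cond; apply: sumr_ge0 => l; rewrite andbT => lk.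
by apply: mulr_ge0; [exact: p_ge0|apply: n0; lia].
Qed.

(** Transition probabilities sum to 1, so an additive error in the next value is passed on without
    growth. *)
Lemma bellmanD next (x : R) i k t : (1 <= k <= i)%N -> (i <= n)%N ->
  bellman (fun l => next l + x) i k t = bellman next i k t + x.
Proof.
move=> ki i_n; rewrite /bellman; under eq_bigr do rewrite mulrDr.
by rewrite big_split/= -mulr_suml sum_p1// mul1r addrA.
Qed.

(** Provides the lower bound that makes the real [inf] of the preceding period a genuine infimum. *)
Lemma opt_ge0 s i k : (1 <= k <= i)%N -> (i + s = n)%N -> 0 <= opt s i k.
Proof.
elim: s i k => [|s IH] i k ki isn; first by apply: final_value_ge0; lia.
apply: lb_le_inf; first by exists (bellman (opt s i.+1) i k 0); exists 0 => //=.
move=> _ [t /= t0 <-]; apply: bellman_ge0 => //; first lia.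
by move=> l lk; apply: IH; lia.
Qed.

Lemma has_inf_bellman s i k : (1 <= k <= i)%N -> (i + s.+1 = n)%N ->
  has_inf [set bellman (opt s i.+1) i k t | t in [set t | 0 <= t]].
Proof.
move=> ki isn; split; first by exists (bellman (opt s i.+1) i k 0); exists 0 => //=.
exists 0 => _ [t /= t0 <-]; apply: bellman_ge0 => //; first lia.
by move=> l lk; apply: opt_ge0; lia.
Qed.

Lemma opt_le_policy_value tau s i k : (forall j l, 0 <= tau j l) ->
  (1 <= k <= i)%N -> (i + s = n)%N -> opt s i k <= policy_value n mu omega tau s i k.
Proof.
move=> tau0; elim: s i k => [|s IH] i k ki isn //.
have [_ lb] := has_inf_bellman ki isn.
apply: (@le_trans _ _ (bellman (opt s i.+1) i k (tau i k))).
  by apply: ge_inf => //; exists (tau i k) => //=.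
apply: bellman_le => //; first lia.
by move=> l lk; apply: IH; lia.
Qed.

(** One policy must serve all states: a decision within e of the infimum is chosen for every pair
    (i, k), and the errors add up over the remaining periods. *)
Lemma exists_good_policy (e : R) : 0 < e -> exists tau : nat -> nat -> R,
  (forall j l, 0 <= tau j l) /\
  forall s i k, (1 <= k <= i)%N -> (i + s = n)%N ->
    policy_value n mu omega tau s i k <= opt s i k + s%:R * e.
Proof.
move=> e0.
have ex (x : nat * nat) : exists t, 0 <= t /\ forall s, (1 <= x.2 <= x.1)%N -> (x.1 + s.+1
  = n)%N ->
    bellman (opt s x.1.+1) x.1 x.2 t <= opt s.+1 x.1 x.2 + e.
  case: x => i k /=; have [h|h] := boolP ((1 <= k <= i)%N && (i < n)%N); last first.
    (* A default for pairs that are not states or have no next arrival. *)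
    by exists 0; split => // s ki isn; exfalso; lia.
  have [ki i_n] := andP h; have isn : (i + (n - i).-1.+1 = n)%N by lia.
  have [_ [t /= t0 <-] lt] := inf_adherent e0 (has_inf_bellman ki isn).
  exists t; split => // s _ isn'.
  by move: lt; rewrite (_ : (n - i).-1 = s)%N; [exact: ltW|lia].
have [tau tauP] := choice ex.
exists (fun j l => tau (j, l)); split; first by move=> j l; have [] := tauP (j, l).
elim=> [|s IH] i k ki isn; first by rewrite mul0r addr0.
have [t0 le] := tauP (i, k).
apply: (@le_trans _ _ (bellman (fun l => opt s i.+1 l + s%:R * e) i k (tau (i, k)))).
  apply: bellman_le => //; first lia.
  by move=> l lk; apply: IH; lia.
rewrite bellmanD//; last lia.
apply: (le_trans (lerD (le s ki isn) (lexx _))).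
by rewrite -natr1 mulrDl mul1r -addrA (addrC e).
Qed.

End dynamic_programming.

Section optimal_cost.
Context (R : realType) (n : nat) (mu : nat -> R) (omega : R).
Context (d : measure_display) (T : measurableType d) (P : probability T R).
Variable B : nat -> {RV P >-> R}.
Hypothesis mu_gt0 : forall i, (1 <= i <= n)%N -> 0 < mu i.
Hypothesis mu_distinct : forall i j, (1 <= i <= n)%N -> (1 <= j <= n)%N ->
  mu i = mu j -> i = j.
Hypothesis omega01 : 0 <= omega <= 1.
Hypothesis B_indep : mutually_independent n B.
Hypothesis B_exp : forall i, (1 <= i <= n)%N -> exponentially_distributed (mu i) (B i).

Lemma optimal_cost_opt i k : (1 <= k <= i)%N -> (i <= n)%N ->
  optimal_cost n omega B i k = (opt n mu omega (n - i) i k)%:E.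
Proof.
move=> ki i_n; have isn : (i + (n - i) = n)%N by lia.
apply/eqP; rewrite eq_le; apply/andP; split.
  apply/lee_addgt0Pr => e e0.
  (* Each of the n - i remaining decisions loses at most e'; the successor keeps the denominator
     nonzero for i = n. *)
  pose e' := e / (n - i).+1%:R.
  have e'0 : 0 < e' by rewrite divr_gt0.
  have [tau0 [tau0_ge0 tau0P]] := exists_good_policy mu_gt0 mu_distinct omega01 e'0.
  (* Before the arrival of client i, waiting for a unit of time makes all states
     possible. *)
  pose tau j l := if (j < i)%N then 1 else tau0 j l.
  have tau_ge0 j l : 0 <= tau j l by rewrite /tau; case: ifP.
  have r0 : 0 < reach mu tau i.-1 1 1 k.
    apply: (reach_gt0 mu_gt0 mu_distinct tau_ge0) => //; first lia.
      by move=> j l ji; rewrite /tau ifT ?ltr01//; lia.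
    by case: eqP => [i0|_]; [apply/eqP; lia|lia].
  have condE := cond_expectation_cost mu_gt0 mu_distinct B_indep B_exp tau_ge0 i_n ki
    omega01 r0.
  apply: (@le_trans _ _ (policy_value n mu omega tau (n - i) i k)%:E).
    rewrite -condE; apply: ereal_inf_lbound; exists tau => //; split => //.
    by rewrite (probability_state_event mu_gt0 mu_distinct B_indep B_exp) // lte_fin.
  rewrite -EFinD lee_fin (@eq_policy_value _ _ _ _ tau tau0); last first.
    by move=> j l ij; rewrite /tau ltnNge ij.
  rewrite (le_trans (tau0P _ _ _ ki isn))// lerD2l /e' mulrA ler_pdivrMr// mulrC.
  by rewrite ler_pM2l// ler_nat.
apply: le_ereal_inf_tmp => _ [tau [tau_ge0 P0] <-].
rewrite (cond_expectation_cost mu_gt0 mu_distinct)//; last first.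
  by rewrite -lte_fin -(probability_state_event mu_gt0 mu_distinct B_indep B_exp).
by rewrite lee_fin; exact: opt_le_policy_value.
Qed.

End optimal_cost.


Theorem theorem2 (R : realType) (n : nat) (mu : nat -> R) (omega : R)
    (d : measure_display) (T : measurableType d) (P : probability T R)
    (B : nat -> {RV P >-> R})
    (mu_gt0 : forall i, (1 <= i <= n)%N -> 0 < mu i)
    (mu_distinct : forall i j, (1 <= i <= n)%N -> (1 <= j <= n)%N ->
       mu i = mu j -> i = j)
    (omega01 : 0 <= omega <= 1)
    (B_indep : mutually_independent n B)
    (B_exp : forall i, (1 <= i <= n)%N ->
       exponentially_distributed (mu i) (B i)) :
  (forall i k : nat, (1 <= i < n)%N -> (1 <= k <= i)%N ->
     optimal_cost n omega B i k =
     ereal_inf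
       [set ((omega * f mu k i t + (1 - omega) * g mu k i t)%:E
             + \sum_(1 <= l < k.+2)
                 (p mu k l i t)%:E * optimal_cost n omega B i.+1 l)%E
        | t in [set t : R | 0 <= t]])
  /\
  (forall k : nat, (1 <= k <= n)%N ->
     [/\ cvg (g mu k n t @[t --> +oo]),
         optimal_cost n omega B n k
           = ((1 - omega) * lim (g mu k n t @[t --> +oo]))%:E &
         (1 - omega) * lim (g mu k n t @[t --> +oo])
           = (1 - omega) *
             \sum_(0 <= l < k) (k - l - 1)%:R * (mu (n - k + l + 1)%N)^-1]).

Proof.
have opt_cost := optimal_cost_opt mu_gt0 mu_distinct omega01 B_indep B_exp.
split=> [i k i_n ki|k kn].
  have [i1 iN] := andP i_n.
  have -> : [set ((omega * f mu k i t + (1 - omega) * g mu k i t)%:E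
      + \sum_(1 <= l < k.+2) (p mu k l i t)%:E * optimal_cost n omega B i.+1 l)%E
        | t in [set t : R | 0 <= t]] =
      [set r%:E | r in [set bellman mu omega (opt n mu omega (n - i).-1 i.+1) i k t
        | t in [set t | 0 <= t]]].
    rewrite image_comp; apply: eq_imagel => t _ /=.
    rewrite /bellman [RHS]EFinD -sumEFin; congr (_ + _)%E.
    apply: eq_big_nat => l lk; rewrite opt_cost ?EFinM; [|lia|lia].
    by congr (_ * (opt _ _ _ _ _ _)%:E)%E; lia.
  rewrite opt_cost//; last lia.
  have isn : (i + (n - i).-1.+1 = n)%N by lia.
  have [ne lb] := has_inf_bellman mu_gt0 mu_distinct omega01 ki isn.
  rewrite ereal_inf_EFin//; congr EFin.
  (* Exposing a successor lets [opt] unfold to its infimum. *)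
  by rewrite (_ : n - i = (n - i).-1.+1)%N; last lia.
have good : distinct_rates mu (n - k).+1 k.-1.
  by apply: (distinct_rates_le mu_gt0 mu_distinct) => //; lia.
have gcvg := cvg_g kn good.
have glim := cvg_lim (@Rhausdorff R) gcvg.
split; first by apply/cvg_ex; eexists; exact: gcvg.
- by rewrite glim opt_cost ?leqnn// subnn.
- by rewrite glim.
Qed.
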